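(* Let $\mathcal{H}$ be a finite-dimensional Hilbert space and $\{\rho_\theta;\theta\in\Theta\subset\mathbb{R}^d\}$ a smooth parametric family of density operators on $\mathcal{H}$, and let $\theta_0\in\Theta$ with $\rho_{\theta_0}$ strictly positive. Let $(M,\hat\theta)$ be any locally unbiased estimator at $\theta_0$, let $G$ be any $d\times d$ real positive matrix, and let $P:(0,\infty)\to(0,\infty)$ be an operator monotone function with $P(1)=1$ and $\frac{d}{dx}P(x)\big|_{x=1}=\frac{1+\beta}{2}$ for some $\beta\in[-1,1]$. Then $$\operatorname{Tr} G V_{\theta_0}[M,\hat\theta]\ \ge\ \operatorname{Tr} G (J^{(M)}_{\theta_0})^{-1}\ \ge\ C^{(|\beta|)}_{\theta_0,G}\ \ge\ C^{(P)}_{\theta_0,G}.$$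
   Context: Write $\rho=\rho_{\theta_0}$ and $\partial_i\rho=\frac{\partial}{\partial\theta^i}\rho_\theta|_{\theta=\theta_0}$. An estimator is a pair $(M,\hat\theta)$ of a POVM $M=\{M_x\}_{x\in\mathcal{X}}$ on a finite set $\mathcal{X}$ and a map $\hat\theta:\mathcal{X}\to\Theta$; it is locally unbiased at $\theta_0$ if $\sum_x\hat\theta^i(x)\operatorname{Tr}\rho M_x=\theta_0^i$ and $\sum_x\hat\theta^i(x)\operatorname{Tr}(\partial_j\rho) M_x=\delta^i_j$ for all $i,j$. Its covariance matrix is $V_{\theta_0}[M,\hat\theta]_{ij}=\sum_x(\hat\theta^i(x)-\theta_0^i)(\hat\theta^j(x)-\theta_0^j)\operatorname{Tr}\rho M_x$. The classical Fisher information matrix of $M$ is $J^{(M)}_{\theta_0,ij}=\sum_x\frac{(\operatorname{Tr}\partial_i\rho M_x)(\operatorname{Tr}\partial_j\rho M_x)}{\operatorname{Tr}\rho M_x}$. For an operator monotone $P$ with $P(1)=1$, let $\mathbf{L}_\rho(X)=\rho X$, $\mathbf{R}_\rho(X)=X\rho$ on $\mathcal{B}(\mathcal{H})$, define the monotone metric $K^{(P)}_\rho(X,Y)=\operatorname{Tr}X^*[(\mathbf{R}_\rho P(\mathbf{L}_\rho\mathbf{R}_\rho^{-1}))^{-1}Y]$, and $J^{(P)}_{\theta_0}=[K^{(P)}_\rho(\partial_i\rho,\partial_j\rho)]_{ij}$. For a positive complex matrix $J$ set $C(J)=\operatorname{Tr}GJ^{-1}+\operatorname{Tr}|\sqrt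 G\,\operatorname{Im}(J^{-1})\sqrt G|$ (Im is the entrywise imaginary part, $|X|=(X^*X)^{1/2}$), and $C^{(P)}_{\theta_0,G}=C(J^{(P)}_{\theta_0})$. For $\beta\in[-1,1]$, $C^{(\beta)}_{\theta_0,G}:=C^{(P^{(\beta)})}_{\theta_0,G}$ with $P^{(\beta)}(x)=\frac{1+\beta}{2}x+\frac{1-\beta}{2}$; equivalently $J^{(P^{(\beta)})}_{\theta_0}=[\operatorname{Tr}\partial_i\rho\,L^{(\beta)}_j]_{ij}$ where $L_i^{(\beta)}$ is defined by $\partial_i\rho=\frac{1+\beta}{2}\rho L_i^{(\beta)}+\frac{1-\beta}{2}L_i^{(\beta)}\rho$. Fisher information matrices are assumed invertible. *)

(* Defs.v *)
From HB Require Import structures.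
From mathcomp Require Import all_boot all_order all_algebra.
From mathcomp Require Import all_classical all_reals all_analysis.
From mathcomp Require Import complex.

Set Implicit Arguments.
Unset Strict Implicit.
Unset Printing Implicit Defensive.

Import Order.TTheory GRing.Theory Num.Theory.
Local Open Scope ring_scope.
Local Open Scope classical_set_scope.

Section QDefs.
Variable R : realType.
Local Notation C := (R[i]).

Definition toC (x : R) : C := Complex x 0.

Definition adj m k (A : 'M[C]_(m, k)) : 'M[C]_(k, m) := (map_mx (@conjc R) A)^T.

Definition psd m (A : 'M[C]_m) : Prop :=
  forall v : 'cV[C]_m, 0 <= (adj v *m A *m v) 0 0.

Definition posdef m (A : 'M[C]_m) : Prop := psd A /\ A \in unitmx.

Definition unitary m (U : 'M[C]_m) : Prop := U *m adj U = 1%:M.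

Definition is_spec_calc m (f : R -> R) (A B : 'M[C]_m) : Prop :=
  exists (U : 'M[C]_m) (l : 'rV[R]_m), unitary U /\
    A = U *m diag_mx (map_mx toC l) *m adj U /\
    B = U *m diag_mx (map_mx (fun x => toC (f x)) l) *m adj U.

Definition spec_calc m (f : R -> R) (A : 'M[C]_m) : 'M[C]_m :=
  xget 0 [set B | is_spec_calc f A B].

Definition operator_monotone (f : R -> R) : Prop :=
  forall m (A B : 'M[C]_m), posdef A -> posdef B -> psd (B - A) ->
    psd (spec_calc f B - spec_calc f A).

Definition sqrtm m (A : 'M[C]_m) : 'M[C]_m :=
  xget 0 [set B | psd B /\ B *m B = A].

Definition absm m (A : 'M[C]_m) : 'M[C]_m := sqrtm (adj A *m A).

Definition density_op m (A : 'M[C]_m) : Prop := psd A /\ \tr A = 1.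

Definition POVM (X : finType) m (M : X -> 'M[C]_m) : Prop :=
  (forall x, psd (M x)) /\ \sum_x M x = 1%:M.

Definition pderiv m d (rho : 'rV[R]_d -> 'M[C]_m) (th0 : 'rV[R]_d) (i : 'I_d)
  : 'M[C]_m :=
  \matrix_(a, b) Complex ('D_(delta_mx 0 i) (fun th => complex.Re (rho th a b)) th0)
                         ('D_(delta_mx 0 i) (fun th => complex.Im (rho th a b)) th0).

Definition locally_unbiased (X : finType) m d (rho : 'rV[R]_d -> 'M[C]_m)
  (th0 : 'rV[R]_d) (M : X -> 'M[C]_m) (th : X -> 'rV[R]_d) : Prop :=
  (forall i : 'I_d, \sum_x toC (th x 0 i) * \tr (rho th0 *m M x) = toC (th0 0 i))
  /\ (forall i j : 'I_d,
      \sum_x toC (th x 0 i) * \tr (pderiv rho th0 j *m M x) = (i == j)%:R).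

Definition cov_matrix (X : finType) m d (rho : 'rV[R]_d -> 'M[C]_m)
  (th0 : 'rV[R]_d) (M : X -> 'M[C]_m) (th : X -> 'rV[R]_d) : 'M[C]_d :=
  \matrix_(i, j) \sum_x
     toC ((th x 0 i - th0 0 i) * (th x 0 j - th0 0 j)) * \tr (rho th0 *m M x).

Definition classical_fisher (X : finType) m d (rho : 'rV[R]_d -> 'M[C]_m)
  (th0 : 'rV[R]_d) (M : X -> 'M[C]_m) : 'M[C]_d :=
  \matrix_(i, j) \sum_x
     \tr (pderiv rho th0 i *m M x) * \tr (pderiv rho th0 j *m M x)
       / \tr (rho th0 *m M x).

(* superoperators on B(H) = 'M_m, represented (via mxvec, row-vector
   convention) as (m*m) x (m*m) matrices *)
Definition supmat m (f : 'M[C]_m -> 'M[C]_m) : 'M[C]_(m * m) := lin_mx f.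

(* monotone metric K^(P)_rho(X,Y) = Tr X^* [(R_rho P(L_rho R_rho^{-1}))^{-1} Y] *)
Definition monotone_metric m (P : R -> R) (r X Y : 'M[C]_m) : C :=
  let Omega := supmat (fun Z => r *m Z *m invmx r) in
  let PW := spec_calc P Omega in
  let Rr := supmat (fun Z => Z *m r) in
  \tr (adj X *m vec_mx (mxvec Y *m invmx (PW *m Rr))).

Definition quantum_fisher m d (P : R -> R) (rho : 'rV[R]_d -> 'M[C]_m)
  (th0 : 'rV[R]_d) : 'M[C]_d :=
  \matrix_(i, j) monotone_metric P (rho th0) (pderiv rho th0 i) (pderiv rho th0 j).

Definition Cbound d (G : 'M[R]_d) (J : 'M[C]_d) : C :=
  let Gc := map_mx toC G in
  let sG := sqrtm Gc in
  let ImJ := map_mx (fun z => toC (complex.Im z)) (invmx J) in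
  \tr (Gc *m invmx J) + \tr (absm (sG *m ImJ *m sG)).

Definition Pbeta (beta : R) : R -> R :=
  fun x => (1 + beta) / 2 * x + (1 - beta) / 2.

End QDefs.

(* Main.v *)
Require Import Defs.
From HB Require Import structures.
From mathcomp Require Import all_boot all_order all_algebra.
From mathcomp Require Import all_classical all_reals all_analysis.
From mathcomp Require Import complex spectral lra ring.
Import Order.TTheory GRing.Theory Num.Theory numFieldNormedType.Exports.
Local Open Scope ring_scope.
Local Open Scope classical_set_scope.
Set Implicit Arguments.
Unset Strict Implicit.
Unset Printing Implicit Defensive.

(* Everything is expressed in an eigenbasis of rho = U diag(p) U^*, in which
   K^(P)(X, Y) is the sum over (a, b) of conj(X'_ab) Y'_ab / (P(p_a/p_b) p_b)
   with X' = U^* X U.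

   An operator monotone P lies below its tangent at 1: rotating diag(x, 1) gives
   a 2x2 matrix dominated by diag(1 + t (x - 1) + t^2, N) for N large, and the
   top-left entries after applying P compare P 1 + t (P x - P 1) with
   P (1 + t (x - 1) + t^2); let t tend to 0. Hence J^(beta) <= J^(P) termwise.

   The inequality J^(M) <= J^(beta) is the variational bound
   <Z, S^-1 Z> >= 2 Re <Y, Z> - <Y, S Y> at Y = sum_x (tr Z M_x / tr rho M_x) M_x,
   combined with Y Y^* <= sum_x |y_x|^2 M_x.

   Both become inequalities between bounds because C is monotone in J^-1: if
   A >= B, then T = S Re(A - B) S + |S Im(A) S| with S = sqrt G dominates
   +i S Im(B) S and -i S Im(B) S, so the trace norm of the latter is at most tr T.
   Complex conjugation exchanges beta and -beta and leaves C unchanged. The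
   first inequality is the classical Cramer-Rao bound. *)

HB.instance Definition _ (R : realType) :=
  GRing.RMorphism.copy (@toC R) (@real_complex_def R (Phant R)).

(** * Adjoints of complex matrices and the embedding of the reals *)

Section Adjoint.
Variable R : realType.
Local Notation C := R[i].
Implicit Types m n k : nat.

Lemma adjE m k (A : 'M[C]_(m, k)) i j : adj A i j = conjc (A j i).
Proof. by rewrite !mxE. Qed.

Lemma adjK m k (A : 'M[C]_(m, k)) : adj (adj A) = A.
Proof. by apply/matrixP => i j; rewrite !adjE conjcK. Qed.

Lemma adjM m n k (A : 'M[C]_(m, n)) (B : 'M[C]_(n, k)) :
  adj (A *m B) = adj B *m adj A.
Proof. by rewrite /adj map_mxM trmx_mul. Qed.

Lemma adjD m k (A B : 'M[C]_(m, k)) : adj (A + B) = adj A + adj B.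
Proof. by rewrite /adj map_mxD linearD. Qed.

Lemma adjN m k (A : 'M[C]_(m, k)) : adj (- A) = - adj A.
Proof. by rewrite /adj map_mxN linearN. Qed.

Lemma adjB m k (A B : 'M[C]_(m, k)) : adj (A - B) = adj A - adj B.
Proof. by rewrite adjD adjN. Qed.

Lemma adj_scale m k a (A : 'M[C]_(m, k)) : adj (a *: A) = conjc a *: adj A.
Proof. by rewrite /adj map_mxZ linearZ. Qed.

Lemma adj0 m k : adj (0 : 'M[C]_(m, k)) = 0.
Proof. by rewrite /adj map_mx0 trmx0. Qed.

Lemma adj_sum (I : finType) m k (F : I -> 'M[C]_(m, k)) :
  adj (\sum_i F i) = \sum_i adj (F i).
Proof. by apply: (big_morph _ (@adjD m k) (adj0 m k)). Qed.

Lemma adj_diag_toC n (l : 'rV[R]_n) :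
  adj (diag_mx (map_mx (@toC R) l)) = diag_mx (map_mx (@toC R) l).
Proof.
apply/matrixP => i j; rewrite adjE !mxE eq_sym; case: eqVneq => [->|_].
  by rewrite !mulr1n /= oppr0.
by rewrite !mulr0n conjc0.
Qed.

Lemma unitary_adjl m (U : 'M[C]_m) : unitary U -> adj U *m U = 1%:M.
Proof. exact: mulmx1C. Qed.

Lemma adj_inv n (A : 'M[C]_n) : A \in unitmx -> adj (invmx A) = invmx (adj A).
Proof. by move=> uA; rewrite /adj map_invmx trmx_inv. Qed.

Lemma conjcM (x y : C) : conjc (x * y) = conjc x * conjc y.
Proof. exact: rmorphM. Qed.

Lemma conjcB (x y : C) : conjc (x - y) = conjc x - conjc y.
Proof. exact: rmorphB. Qed.

Lemma conjc_sum (I : finType) (F : I -> C) :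
  conjc (\sum_i F i) = \sum_i conjc (F i).
Proof. exact: rmorph_sum. Qed.

Lemma mxtr_adj n (A : 'M[C]_n) : \tr (adj A) = conjc (\tr A).
Proof.
rewrite /adj mxtrace_tr /mxtrace rmorph_sum.
by apply: eq_bigr => i _; rewrite mxE.
Qed.

Lemma toC_ge0 (x : R) : (0 <= toC x) = (0 <= x).
Proof. by rewrite /toC lecE /= eqxx. Qed.

Lemma toC_inj : injective (@toC R).
Proof. by move=> x y []. Qed.

Lemma conjc_eq_toC (z : C) : conjc z = z -> z = toC (complex.Re z).
Proof.
case: z => a b [] hb; rewrite /toC /=; congr Complex.
by apply/eqP; rewrite -eqNr; apply/eqP.
Qed.

Lemma conj_toC (x : R) : conjc (toC x) = toC x.
Proof. by rewrite /toC /= oppr0. Qed.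

Lemma conj_i : conjc 'i%C = - 'i%C :> C.
Proof. by apply/eqP; rewrite eq_complex /= oppr0 !eqxx. Qed.

End Adjoint.

(** * Positive semidefinite matrices, spectral calculus and the trace norm *)

Section Psd.
Variable R : realType.
Local Notation C := R[i].
Implicit Types m n k : nat.

Lemma psd_cong m k (A : 'M[C]_m) (B : 'M[C]_(m, k)) :
  psd A -> psd (adj B *m A *m B).
Proof. by move=> pA v; have := pA (B *m v); rewrite adjM !mulmxA. Qed.

Lemma psd_congr m k (A : 'M[C]_m) (B : 'M[C]_(k, m)) :
  psd A -> psd (B *m A *m adj B).
Proof. by move=> /(psd_cong (adj B)); rewrite adjK. Qed.

Lemma psd1 n : psd (1%:M : 'M[C]_n).
Proof.
move=> v; rewrite mulmx1 mxE; apply: sumr_ge0 => i _.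
by rewrite adjE mulrC; apply: mul_conjC_ge0.
Qed.

Lemma psd_mul_adj m k (B : 'M[C]_(m, k)) : psd (B *m adj B).
Proof. by have := psd_congr B (@psd1 k); rewrite mulmx1. Qed.

Lemma psdD m (A B : 'M[C]_m) : psd A -> psd B -> psd (A + B).
Proof. by move=> pA pB v; rewrite mulmxDr mulmxDl mxE addr_ge0. Qed.

Lemma psdZ m a (A : 'M[C]_m) : 0 <= a -> psd A -> psd (a *: A).
Proof. by move=> a0 pA v; rewrite -scalemxAr -scalemxAl mxE mulr_ge0. Qed.

Lemma psd0 m : psd (0 : 'M[C]_m).
Proof. by move=> v; rewrite mulmx0 mul0mx mxE. Qed.

Lemma psd_sum (I : finType) m (F : I -> 'M[C]_m) :
  (forall i, psd (F i)) -> psd (\sum_i F i).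
Proof. by move=> pF; elim/big_ind: _ => //; [exact: psd0|exact: psdD]. Qed.

Lemma psd_diag_ge0 m (A : 'M[C]_m) i : psd A -> 0 <= A i i.
Proof.
move=> /(_ (delta_mx i 0)).
rewrite (_ : adj _ = delta_mx 0 i); last first.
  by apply/matrixP => a b; rewrite adjE !mxE andbC conjc_nat.
by rewrite -rowE -colE !mxE.
Qed.

Lemma psd_trace_ge0 m (A : 'M[C]_m) : psd A -> 0 <= \tr A.
Proof. by move=> pA; apply: sumr_ge0 => i _; exact: psd_diag_ge0. Qed.

Lemma sesqui_delta m (D : 'M[C]_m) i j (z : C) :
  let v := delta_mx i 0 + z *: delta_mx j 0 : 'cV[C]_m in
  (adj v *m D *m v) 0 0 =
    D i i + z * D i j + conjc z * D j i + conjc z * z * D j j.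
Proof.
have E (k : 'I_m) : adj (delta_mx k 0 : 'cV[C]_m) = delta_mx 0 k.
  by apply/matrixP => a b; rewrite adjE !mxE andbC conjc_nat.
rewrite /= adjD adj_scale !E !mulmxDl !mulmxDr -!scalemxAl -!scalemxAr.
rewrite -!rowE -!colE !mxE; ring.
Qed.

(* The form of a psd matrix is real-valued, so it agrees with the form of the
   adjoint; polarization at z = 1 and z = i separates the entries. *)
Lemma psd_herm m (A : 'M[C]_m) : psd A -> adj A = A.
Proof.
move=> pA; apply/eqP; rewrite -subr_eq0; apply/eqP.
have q0 (v : 'cV[C]_m) : (adj v *m (adj A - A) *m v) 0 0 = 0.
  rewrite mulmxBr mulmxBl mxE [X in _ + X]mxE.
  have /geC0_conj := pA v.
  rewrite -[Num.conj _]/(conjc _) -adjE !adjM adjK mulmxA => ->.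
  by rewrite subrr.
move: (adj A - A) q0 => D q0.
have d0 i : D i i = 0.
  have := q0 (delta_mx i 0 + 0 *: delta_mx i 0).
  by rewrite sesqui_delta conjc0 !mul0r !addr0.
apply/matrixP => i j; rewrite [RHS]mxE.
have := q0 (delta_mx i 0 + 1 *: delta_mx j 0).
have := q0 (delta_mx i 0 + 'i%C *: delta_mx j 0).
rewrite !sesqui_delta conjc1 !d0 !mulr0 !addr0 !add0r !mul1r.
rewrite conj_i mulNr -mulrBr => /eqP; rewrite mulf_eq0 => /orP[/eqP[]/eqP|].
  by rewrite oner_eq0.
rewrite subr_eq0 => /eqP <- /eqP; rewrite -mulr2n mulrn_eq0 /= => /eqP//.
Qed.

(** Testing against the conjugate vector turns the form into the conjugate of a nonnegative
    number. *)
Lemma psd_conj m (A : 'M[C]_m) : psd A -> psd (map_mx (@conjc R) A).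
Proof.
move=> pA v; have := pA (map_mx (@conjc R) v).
have -> : adj v *m map_mx (@conjc R) A *m v =
    map_mx (@conjc R) (adj (map_mx (@conjc R) v) *m A *m map_mx (@conjc R) v).
  rewrite !map_mxM; congr (_ *m _ *m _); apply/matrixP => i j.
    by rewrite !mxE conjcK.
  by rewrite !mxE /= conjcK.
by rewrite [X in _ -> 0 <= X]mxE conjC_ge0.
Qed.

(* A^-1 - B^-1 = (A^-1 - B^-1) A (A^-1 - B^-1) + B^-1 (B - A) B^-1 *)
Lemma psd_inv_anti m (A B : 'M[C]_m) : psd A -> A \in unitmx ->
  B \in unitmx -> psd (B - A) -> psd (invmx A - invmx B).
Proof.
move=> pA uA uB pBA.
have hA := psd_herm pA.
have hB : adj B = B by have := psd_herm (psdD pBA pA); rewrite subrK.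
have hD : adj (invmx A - invmx B) = invmx A - invmx B.
  by rewrite adjB !adj_inv // hA hB.
have := psdD (psd_cong (invmx A - invmx B) pA) (psd_cong (invmx B) pBA).
congr psd; rewrite hD adj_inv // hB.
rewrite mulmxBl mulVmx // mulmxBl mul1mx [invmx B *m A *m _]mulmxBr mulmxK //.
by rewrite mulmxBr mulVmx // mulmxBl mul1mx subrK.
Qed.

Lemma spectral_herm m (A : 'M[C]_m) : adj A = A ->
  exists (U : 'M[C]_m) (l : 'rV[R]_m), unitary U /\
    A = U *m diag_mx (map_mx (@toC R) l) *m adj U.
Proof.
move=> hA.
have adjC k l (B : 'M[C]_(k, l)) : (B ^t Num.conj)%sesqui = adj B.
  by apply/matrixP => i j; rewrite !mxE.
have hA' : A \is hermsymmx.
  by apply/is_hermitianmxP; rewrite expr0 scale1r adjC hA.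
have /orthomx_spectralP := hermitian_normalmx hA'.
have := hermitian_spectral_diag_real hA'.
have := spectral_unitarymx A.
set P := spectralmx A; set sp := spectral_diag A => uP rsp EA.
exists (adj P), (map_mx (@complex.Re R) sp); split.
  by move/unitarymxP: uP; rewrite adjC /unitary adjK => /mulmx1C.
have {}EP : invmx P = adj P by rewrite invmx_unitary // adjC.
rewrite adjK {1}EA EP; congr (_ *m diag_mx _ *m _).
apply/matrixP => i j; rewrite !mxE; apply: conjc_eq_toC.
by have /mxOverP/(_ i j)/CrealP := rsp.
Qed.

Lemma unitary_diag_entry m (U : 'M[C]_m) (l : 'rV[R]_m) i : unitary U ->
  (adj U *m (U *m diag_mx (map_mx (@toC R) l) *m adj U) *m U) i i = toC (l 0 i).
Proof.
move=> uU; rewrite !mulmxA (unitary_adjl uU) mul1mx -mulmxA (unitary_adjl uU) mulmx1.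
by rewrite !mxE eqxx mulr1n.
Qed.

Lemma spectral_psd m (A : 'M[C]_m) : psd A ->
  exists (U : 'M[C]_m) (l : 'rV[R]_m), [/\ unitary U,
    A = U *m diag_mx (map_mx (@toC R) l) *m adj U & forall i, 0 <= l 0 i].
Proof.
move=> pA; have [U [l [uU EA]]] := spectral_herm (psd_herm pA).
exists U, l; split => // i; rewrite -toC_ge0.
by rewrite -(unitary_diag_entry l i uU) -EA; apply/psd_diag_ge0/psd_cong.
Qed.

Lemma psd_diag m (l : 'rV[R]_m) :
  (forall i, 0 <= l 0 i) -> psd (diag_mx (map_mx (@toC R) l)).
Proof.
move=> l0 v; rewrite -mulmxA mul_diag_mx mxE; apply: sumr_ge0 => i _.
by rewrite adjE !mxE mulrCA mulr_ge0 ?toC_ge0 // mulrC; apply: mul_conjC_ge0.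
Qed.

(** The matrix [W = adj V *m U] intertwines the two diagonals: [W i j * l j = k i * W i j]. So
    [l j = k i] wherever [W i j] is nonzero, and [W] intertwines the values of [f] as well. This is
    what makes the choice in [spec_calc] computable. *)
Lemma is_spec_calc_uniq m f (A B B' : 'M[C]_m) :
  is_spec_calc f A B -> is_spec_calc f A B' -> B = B'.
Proof.
move=> [U [l [uU [-> ->]]]] [V [k [uV [E ->]]]].
have {}E : adj V *m U *m diag_mx (map_mx (@toC R) l) =
    diag_mx (map_mx (@toC R) k) *m (adj V *m U).
  rewrite -[LHS]mulmx1 -(unitary_adjl uU) !mulmxA -[adj V *m _ *m _ *m _]mulmxA.
  rewrite -[adj V *m _ *m _]mulmxA mulmxA.
  move: (congr1 (fun Z => adj V *m Z *m U) E); rewrite /= !mulmxA => ->.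
  by rewrite (unitary_adjl uV) mul1mx.
have {}E : adj V *m U *m diag_mx (map_mx (fun x => toC (f x)) l) =
    diag_mx (map_mx (fun x => toC (f x)) k) *m (adj V *m U).
  apply/matrixP => i j; move/matrixP: E => /(_ i j).
  rewrite !mul_mx_diag !mul_diag_mx !mxE; set w := \sum_(_ < _) _.
  have [->|w0] := eqVneq w 0; first by rewrite !mulr0 !mul0r.
  by rewrite mulrC => /(mulIf w0) /toC_inj ->; rewrite mulrC.
rewrite -[RHS](mulmx1) -uU !mulmxA -[V *m _ *m _ *m U]mulmxA -[V *m _ *m _]mulmxA.
by rewrite -E !mulmxA uV mul1mx.
Qed.

Lemma spec_calcE m f (A B : 'M[C]_m) : is_spec_calc f A B -> spec_calc f A = B.
Proof.
move=> h; apply: xget_unique => // B' h'; exact: is_spec_calc_uniq h' h.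
Qed.

Lemma diag_toC_mul m (l k : 'rV[R]_m) :
  diag_mx (map_mx (@toC R) l) *m diag_mx (map_mx (@toC R) k) =
  diag_mx (map_mx (@toC R) (\row_i (l 0 i * k 0 i))).
Proof.
rewrite mulmx_diag; congr diag_mx; apply/matrixP => i j.
by rewrite !mxE -rmorphM.
Qed.

Lemma unitary_conj_mul m (U A B : 'M[C]_m) : unitary U ->
  (U *m A *m adj U) *m (U *m B *m adj U) = U *m (A *m B) *m adj U.
Proof.
move=> uU; rewrite !mulmxA -[U *m A *m _ *m U]mulmxA (unitary_adjl uU).
by rewrite mulmx1.
Qed.

(** Every psd root of [A] arises by spectral calculus, so uniqueness of psd roots reduces to
    [is_spec_calc_uniq]. *)
Lemma psd_sqrt_spec_calc m (A B : 'M[C]_m) :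
  psd B -> B *m B = A -> is_spec_calc Num.sqrt A B.
Proof.
move=> pB EA; have [U [l [uU EB l0]]] := spectral_psd pB.
exists U, (\row_i (l 0 i * l 0 i)); split => //; split.
  by rewrite -EA EB (unitary_conj_mul _ _ uU) diag_toC_mul.
rewrite EB; congr (_ *m diag_mx _ *m _); apply/matrixP => i j.
by rewrite !mxE ord1 -expr2 sqrtr_sqr ger0_norm.
Qed.

Lemma psd_sqrt_exists m (A : 'M[C]_m) : psd A -> exists B, psd B /\ B *m B = A.
Proof.
move=> /spectral_psd [U [l [uU -> l0]]].
exists (U *m diag_mx (map_mx (@toC R) (map_mx Num.sqrt l)) *m adj U); split.
  by apply/psd_congr/psd_diag => i; rewrite mxE sqrtr_ge0.
rewrite (unitary_conj_mul _ _ uU) diag_toC_mul; congr (_ *m diag_mx (map_mx _ _) *m _).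
by apply/matrixP => i j; rewrite !mxE ord1 -expr2 sqr_sqrtr.
Qed.

Lemma sqrtmP m (A : 'M[C]_m) :
  psd A -> psd (sqrtm A) /\ sqrtm A *m sqrtm A = A.
Proof. by move=> /psd_sqrt_exists; apply: xgetPex. Qed.

Lemma sqrtmE m (A B : 'M[C]_m) : psd B -> B *m B = A -> sqrtm A = B.
Proof.
move=> pB EA; apply: xget_unique => // B' [pB' EA'].
exact: is_spec_calc_uniq (psd_sqrt_spec_calc pB' EA') (psd_sqrt_spec_calc pB EA).
Qed.

Lemma absm_spectral m (U : 'M[C]_m) (l : 'rV[R]_m) : unitary U ->
  absm (U *m diag_mx (map_mx (@toC R) l) *m adj U) =
  U *m diag_mx (map_mx (@toC R) (map_mx Num.norm l)) *m adj U.
Proof.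
move=> uU; apply: sqrtmE; first by apply/psd_congr/psd_diag => i; rewrite mxE.
rewrite !adjM adjK adj_diag_toC [U *m (_ *m _)]mulmxA.
rewrite !(unitary_conj_mul _ _ uU) !diag_toC_mul.
congr (_ *m diag_mx (map_mx _ _) *m _).
by apply/matrixP => i j; rewrite !mxE -!expr2 real_normK ?num_real.
Qed.

Lemma absm_ge m (H : 'M[C]_m) : adj H = H -> psd (absm H - H) /\ psd (absm H + H).
Proof.
move=> /spectral_herm [U [l [uU ->]]]; rewrite (absm_spectral _ uU).
rewrite -!mulmxBl -!mulmxDl -!mulmxBr -!mulmxDr.
rewrite -!linearB -!linearD /=.
have psdU (k : 'rV[R]_m) : (forall i, 0 <= k 0 i) ->
  psd (U *m diag_mx (map_mx (@toC R) k) *m adj U).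
  by move=> k0; apply/psd_congr/psd_diag.
split.
  have := psdU (map_mx Num.norm l - l); rewrite [map_mx (@toC R) _]raddfB; apply => i.
  by rewrite !mxE subr_ge0 ler_norm.
have := psdU (map_mx Num.norm l + l); rewrite [map_mx (@toC R) _]raddfD; apply => i.
by rewrite !mxE -lerBlDr sub0r -normrN ler_norm.
Qed.

Lemma trace_unitary m (U T : 'M[C]_m) : unitary U -> \tr (adj U *m T *m U) = \tr T.
Proof. by move=> uU; rewrite mxtrace_mulC mulmxA uU mul1mx. Qed.

(** In an eigenbasis of [H] the diagonal entries of [T] dominate both [l i] and [- l i], hence the
    absolute value; only these diagonals are compared. *)
Lemma trace_absm_le m (T H : 'M[C]_m) : adj H = H ->
  psd (T - H) -> psd (T + H) -> \tr (absm H) <= \tr T.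
Proof.
move=> /spectral_herm [U [l [uU EH]]] pB pD; rewrite EH (absm_spectral _ uU).
rewrite -(trace_unitary T uU) -(trace_unitary (U *m _ *m _) uU).
apply: ler_sum => i _; rewrite (unitary_diag_entry _ _ uU) mxE.
have := psd_diag_ge0 i (psd_cong U pD); have := psd_diag_ge0 i (psd_cong U pB).
rewrite EH mulmxBr mulmxBl mulmxDr mulmxDl mxE [X in _ + X]mxE.
rewrite [X in _ -> 0 <= X -> _]mxE.
rewrite (unitary_diag_entry _ _ uU) subr_ge0 -lerBlDr sub0r.
by case: (ger0P (l 0 i)); rewrite ?raddfN.
Qed.

(** By cyclicity the trace is that of [S *m B *m S], with [S] a psd root of [A]. *)
Lemma psd_trace_mul_ge0 m (A B : 'M[C]_m) : psd A -> psd B -> 0 <= \tr (A *m B).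
Proof.
move=> pA pB; have [S [pS <-]] := psd_sqrt_exists pA.
rewrite -mulmxA mxtrace_mulC -{1}(psd_herm pS).
exact/psd_trace_ge0/psd_cong.
Qed.

End Psd.

(** * The bound C: monotonicity in the inverse matrix, and conjugation *)

Section Bound.
Variable R : realType.
Local Notation C := R[i].
Local Notation remx := (map_mx (fun z : C => toC (complex.Re z))).
Local Notation immx := (map_mx (fun z : C => toC (complex.Im z))).
Local Notation "'I'" := ('i%C : C).

Lemma mulii : I * I = -1.
Proof.
by apply/eqP; rewrite eq_complex /= !mulr0 !mul0r !mulr1 sub0r addr0 oppr0 !eqxx.
Qed.

Lemma mx_re_im m (A : 'M[C]_m) : A = remx A + I *: immx A.
Proof.
apply/matrixP => i j; rewrite !mxE; case: (A i j) => a b.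
by apply/eqP; rewrite eq_complex /= !mulr0 !mul0r !mul1r subr0 ?addr0 ?add0r !eqxx.
Qed.

Lemma mx_conj_re_im m (A : 'M[C]_m) :
  map_mx (@conjc R) A = remx A - I *: immx A.
Proof.
apply/matrixP => i j; rewrite !mxE; case: (A i j) => a b.
by apply/eqP; rewrite eq_complex /= !mulr0 !mul0r !mul1r subr0 oppr0 ?addr0 ?add0r !eqxx.
Qed.

Lemma immxB m (A B : 'M[C]_m) : immx (A - B) = immx A - immx B.
Proof.
apply/matrixP => i j; rewrite !mxE -rmorphB; congr toC.
by case: (A i j) (B i j) => [a b] [a' b'].
Qed.

Lemma immx_tr_herm m (A : 'M[C]_m) : adj A = A -> (immx A)^T = - immx A.
Proof.
move=> hA; apply/matrixP => i j; rewrite !mxE -{1}hA adjE -rmorphN.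
by congr toC; case: (A i j).
Qed.

Lemma adj_immx_herm m (A : 'M[C]_m) : adj A = A -> adj (immx A) = - immx A.
Proof.
move=> hA; rewrite -(immx_tr_herm hA) /adj; congr trmx.
by apply/matrixP => i j; rewrite !mxE conj_toC.
Qed.

Lemma absm_mul_i m (A : 'M[C]_m) : absm (I *: A) = absm A.
Proof.
rewrite /absm adj_scale conj_i -scalemxAl -scalemxAr scalerA mulNr mulii.
by rewrite opprK scale1r.
Qed.

Lemma absmN m (A : 'M[C]_m) : absm (- A) = absm A.
Proof. by rewrite /absm adjN mulmxN mulNmx opprK. Qed.

Lemma absm0 m : absm (0 : 'M[C]_m) = 0.
Proof. by apply: sqrtmE; [exact: psd0|rewrite !mulmx0]. Qed.

(** A symmetric matrix is paired with an antisymmetric one, so the trace equals its own negative. *)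
Lemma trace_sym_immx m (G A : 'M[C]_m) :
  G^T = G -> adj A = A -> \tr (G *m immx A) = 0.
Proof.
move=> sG hA; apply/eqP.
have := mulrn_eq0 (\tr (G *m immx A)) 2; rewrite /= => <-; rewrite mulr2n.
rewrite -{1}mxtrace_tr trmx_mul sG (immx_tr_herm hA) mulNmx mxtrace_mulC.
by rewrite raddfN addNr eqxx.
Qed.

(** With v = x + i y the cross terms cancel because [G] is symmetric, leaving the real forms at x
    and y. *)
Lemma psd_toC (m : nat) (G : 'M[R]_m) : G^T = G ->
  (forall v : 'cV[R]_m, 0 <= (v^T *m G *m v) 0 0) -> psd (map_mx (@toC R) G).
Proof.
move=> sG pG v; set x := map_mx (@complex.Re R) v; set y := map_mx (@complex.Im R) v.
have Ev : v = map_mx (@toC R) x + I *: map_mx (@toC R) y.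
  apply/matrixP => i j; rewrite !mxE; case: (v i j) => a b.
  by apply/eqP; rewrite eq_complex /= !mulr0 !mul0r !mul1r subr0 ?addr0 ?add0r !eqxx.
have Eadj (z : 'cV[R]_m) : adj (map_mx (@toC R) z) = map_mx (@toC R) z^T.
  by apply/matrixP => i j; rewrite adjE !mxE conj_toC.
have yGx : y^T *m G *m x = x^T *m G *m y.
  have tr1 (N : 'M[R]_1) : N^T = N by apply/matrixP => i j; rewrite mxE !ord1.
  by rewrite -[RHS]tr1 !trmx_mul trmxK sG mulmxA.
rewrite {}Ev adjD adj_scale !Eadj conj_i !mulmxDl !mulmxDr -!scalemxAl -!scalemxAr.
rewrite -!map_mxM yGx scalerA mulNr mulii opprK scale1r scaleNr.
by rewrite addrA addrK -raddfD /= mxE toC_ge0 mxE addr_ge0.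
Qed.

(* With S = sqrt G, the Hermitian matrices K = i S Im(A) S and H = i S Im(B) S
   satisfy T - H >= 0 and T + H >= 0 for T = S Re(A - B) S + |K|: the former is
   S (A - B) S + (|K| - K), the latter its complex-conjugate analogue. *)
Lemma Cbound_mono d (G : 'M[R]_d) (J1 J2 : 'M[C]_d) : G^T = G ->
  psd (map_mx (@toC R) G) ->
  adj (invmx J1) = invmx J1 -> adj (invmx J2) = invmx J2 ->
  psd (invmx J1 - invmx J2) -> Cbound G J2 <= Cbound G J1.
Proof.
rewrite /Cbound /=; move: (invmx J1) (invmx J2) => A B sG pG hA hB pAB.
have [pS SS] := sqrtmP pG; move: (sqrtm _) pS SS => S pS SS.
have hS := psd_herm pS.
set Gc := map_mx _ G in SS *.
(* The factor i leaves the absolute value unchanged and makes its argument Hermitian, as [absm_ge]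
   and [trace_absm_le] require. *)
set H := I *: (S *m immx B *m S); set K := I *: (S *m immx A *m S).
rewrite -[absm (S *m immx B *m S)]absm_mul_i -/H.
rewrite -[absm (S *m immx A *m S)]absm_mul_i -/K.
have hI X : adj X = X -> adj (I *: (S *m immx X *m S)) = I *: (S *m immx X *m S).
  move=> hX; rewrite adj_scale conj_i !adjM hS adj_immx_herm // mulNmx mulmxN mulmxA.
  by rewrite scaleNr scalerN opprK.
have hH : adj H = H by apply: hI.
have hK : adj K = K by apply: hI.
have [pKB pKD] := absm_ge hK.
have EI : I *: (S *m immx (A - B) *m S) = K - H.
  by rewrite immxB mulmxBr mulmxBl scalerBr.
set T := S *m remx (A - B) *m S + absm K.
have pTB : psd (T - H).
  have := psdD (psd_cong S pAB) pKB; rewrite hS {1}[A - B]mx_re_im.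
  rewrite mulmxDr mulmxDl -scalemxAr -scalemxAl EI; congr psd.
  by rewrite -addrA [_ - H + _]addrC [_ - K + _]addrA subrK addrA.
have pTD : psd (T + H).
  have := psdD (psd_cong S (psd_conj pAB)) pKD; rewrite hS mx_conj_re_im.
  rewrite mulmxBr mulmxBl -scalemxAr -scalemxAl EI; congr psd.
  by rewrite opprB -addrA addrACA addNr addr0 [H + _]addrC addrA.
have := trace_absm_le hH pTB pTD.
have -> : \tr T = \tr (Gc *m A) - \tr (Gc *m B) + \tr (absm K).
  rewrite /T raddfD /=; congr (_ + _).
  (* Cyclicity turns S Re(A - B) S into G Re(A - B); the imaginary part can be added freely, since
     its trace against [G] vanishes. *)
  rewrite mxtrace_mulC mulmxA SS -raddfB -mulmxBr /=.
  rewrite {2}[A - B]mx_re_im mulmxDr -scalemxAr raddfD /= mxtraceZ trace_sym_immx.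
  - by rewrite mulr0 addr0.
  - by rewrite /Gc map_trmx sG.
  - by rewrite adjB hA hB.
move=> h; rewrite -(lerD2l (\tr (Gc *m B))) in h.
by apply: (le_trans h); rewrite addrA addrCA subrr addr0.
Qed.

(** The inverse of a real matrix is real, so the trace-norm term vanishes; this brings the classical
    information matrix into the scope of [Cbound_mono]. *)
Lemma Cbound_real d (G : 'M[R]_d) (J : 'M[C]_d) :
  map_mx (@conjc R) J = J -> Cbound G J = \tr (map_mx (@toC R) G *m invmx J).
Proof.
move=> cJ; rewrite /Cbound /= (_ : immx (invmx J) = 0).
  by rewrite mulmx0 mul0mx absm0 linear0 addr0.
apply/matrixP => i j; rewrite !mxE.
have : map_mx (@conjc R) (invmx J) = invmx J by rewrite map_invmx cJ.
move=> /matrixP/(_ i j); rewrite mxE => /conjc_eq_toC ->.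
exact: rmorph0.
Qed.

(** Conjugating a Hermitian inverse transposes it, which the trace against a symmetric [G] does not
    see; the imaginary part only changes sign. *)
Lemma Cbound_conj d (G : 'M[R]_d) (J : 'M[C]_d) : G^T = G ->
  adj (invmx J) = invmx J -> Cbound G (map_mx (@conjc R) J) = Cbound G J.
Proof.
move=> sG hJ; rewrite /Cbound /= -map_invmx; move: (invmx J) hJ => B hB.
have -> : \tr (map_mx (@toC R) G *m map_mx (@conjc R) B) =
          \tr (map_mx (@toC R) G *m B).
  rewrite -[RHS]mxtrace_tr trmx_mul map_trmx sG [RHS]mxtrace_mulC -{2}hB /adj.
  by rewrite trmxK.
have -> : immx (map_mx (@conjc R) B) = - immx B.
  by apply/matrixP => i j; rewrite !mxE -rmorphN; congr toC; case: (B i j).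
by rewrite mulmxN mulNmx absmN.
Qed.

End Bound.

(** * Operator monotone functions and their tangent at 1 *)

Section Tangent.
Variable R : realType.
Local Notation C := R[i].

Lemma unitary_unitmx m (U : 'M[C]_m) : unitary U -> U \in unitmx.
Proof. by move=> /mulmx1_unit[]. Qed.

Lemma posdef_spectral m (U : 'M[C]_m) (l : 'rV[R]_m) : unitary U ->
  (forall i, 0 < l 0 i) -> posdef (U *m diag_mx (map_mx (@toC R) l) *m adj U).
Proof.
move=> uU l0; split; first by apply/psd_congr/psd_diag => i; exact/ltW.
have uV : adj U \in unitmx by have /mulmx1_unit[] := unitary_adjl uU.
rewrite !unitmx_mul uV (unitary_unitmx uU) andbT /= unitmxE det_diag unitfE.
apply/prodf_neq0 => i _; rewrite mxE; apply/eqP => /(congr1 (@complex.Re R)) /= li0.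
by have := l0 i; rewrite li0 ltxx.
Qed.

Lemma unitary_toC m (u : 'M[R]_m) : u *m u^T = 1%:M -> unitary (map_mx (@toC R) u).
Proof.
move=> uu; rewrite /unitary (_ : adj _ = map_mx (@toC R) u^T).
  by rewrite -map_mxM uu map_mx1.
by apply/matrixP => i j; rewrite adjE !mxE conj_toC.
Qed.

Lemma spectral_toC m (u : 'M[R]_m) (l : 'rV[R]_m) :
  map_mx (@toC R) u *m diag_mx (map_mx (@toC R) l) *m adj (map_mx (@toC R) u) =
  map_mx (@toC R) (u *m diag_mx l *m u^T).
Proof.
rewrite !map_mxM map_diag_mx; congr (_ *m _).
by apply/matrixP => i j; rewrite adjE !mxE conj_toC.
Qed.

Lemma spec_calc_toC m f (u : 'M[R]_m) (l : 'rV[R]_m) : u *m u^T = 1%:M ->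
  spec_calc f (map_mx (@toC R) (u *m diag_mx l *m u^T)) =
  map_mx (@toC R) (u *m diag_mx (map_mx f l) *m u^T).
Proof.
move=> /unitary_toC uu; apply: spec_calcE; exists (map_mx (@toC R) u), l.
split=> //; rewrite -!spectral_toC; split=> //.
by rewrite -map_mx_comp.
Qed.

Lemma posdef_toC m (u : 'M[R]_m) (l : 'rV[R]_m) : u *m u^T = 1%:M ->
  (forall i, 0 < l 0 i) -> posdef (map_mx (@toC R) (u *m diag_mx l *m u^T)).
Proof. by move=> /unitary_toC uu l0; rewrite -spectral_toC; exact: posdef_spectral. Qed.

Let mx2 (a b c d : R) : 'M[R]_2 :=
  \matrix_(i, j) if i == 0 then (if j == 0 then a else b)
                 else (if j == 0 then c else d).
Let rv2 (a b : R) : 'rV[R]_2 := \row_i if i == 0 then a else b.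

Lemma mx2_mul a b c d a' b' c' d' : mx2 a b c d *m mx2 a' b' c' d' =
  mx2 (a * a' + b * c') (a * b' + b * d') (c * a' + d * c') (c * b' + d * d').
Proof.
apply/matrixP => i j; rewrite !mxE big_ord_recl big_ord1 !mxE /=.
by case: (i == 0); case: (j == 0).
Qed.

Lemma mx2_tr a b c d : (mx2 a b c d)^T = mx2 a c b d.
Proof. by apply/matrixP => i j; rewrite !mxE; case: (i == 0); case: (j == 0). Qed.

Lemma mx2_diag a b : diag_mx (rv2 a b) = mx2 a 0 0 b.
Proof.
apply/matrixP => i j; rewrite !mxE.
by case: i j => [[|[|//]] ?] [[|[|//]] ?].
Qed.

Lemma mx2_1 : 1%:M = mx2 1 0 0 1.
Proof.
apply/matrixP => i j; rewrite !mxE.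
by case: i j => [[|[|//]] ?] [[|[|//]] ?].
Qed.

Lemma mx2_sub a b c d a' b' c' d' : mx2 a b c d - mx2 a' b' c' d' =
  mx2 (a - a') (b - b') (c - c') (d - d').
Proof. by apply/matrixP => i j; rewrite !mxE; case: (i == 0); case: (j == 0). Qed.

(* A rotation of diag(a, b) with top-left entry t a + (1 - t) b is dominated by
   diag(t a + (1 - t) b + e, N) for N large; compare the top-left entries after
   applying f. *)
Lemma operator_monotone_chord (f : R -> R) (a b t e : R) :
  operator_monotone f -> 0 < a -> 0 < b -> 0 < t < 1 -> 0 < e ->
  t * f a + (1 - t) * f b <= f (t * a + (1 - t) * b + e).
Proof.
move=> mf a0 b0 /andP[t0 t1] e0.
(* Cosine and sine of the rotation that mixes [a] and [b] with weights [t] and [1 - t]. *)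
set c := Num.sqrt t; set s := Num.sqrt (1 - t).
have cc : c * c = t by rewrite -expr2 sqr_sqrtr ?ltW.
have ss : s * s = 1 - t by rewrite -expr2 sqr_sqrtr ?subr_ge0 ?ltW.
set u := mx2 c s (- s) c.
have uu : u *m u^T = 1%:M.
  by rewrite mx2_tr mx2_mul mx2_1; congr mx2; rewrite ?mulrN ?mulNr; lra.
have Eu x y : u *m diag_mx (rv2 x y) *m u^T =
    mx2 (t * x + (1 - t) * y) (c * s * (y - x)) (c * s * (y - x))
        ((1 - t) * x + t * y).
  rewrite mx2_tr mx2_diag !mx2_mul -cc (_ : 1 - c * c = s * s); last by rewrite cc.
  by congr mx2; ring.
have E1 x y : 1%:M *m diag_mx (rv2 x y) *m (1%:M)^T = mx2 x 0 0 y.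
  by rewrite trmx1 mul1mx mulmx1 mx2_diag.
have u1 : (1%:M : 'M[R]_2) *m 1%:M^T = 1%:M by rewrite trmx1 mulmx1.
(* [k] is the off-diagonal entry of the rotated matrix. The corner [n] is chosen so that the
   difference of the two matrices has entries e, -k, -k, k^2/e: it is e times the rank-one matrix of
   the vector (1, -k/e). *)
set k := c * s * (b - a); set n := (1 - t) * a + t * b + k ^+ 2 / e.
have n0 : 0 < n.
  rewrite /n ltr_wpDr ?divr_ge0 ?sqr_ge0 ?(ltW e0) // addr_gt0 ?mulr_gt0 //.
  by rewrite subr_gt0.
set L := t * a + (1 - t) * b + e.
have L0 : 0 < L by rewrite !addr_gt0 ?mulr_gt0 ?subr_gt0.
have pA : posdef (map_mx (@toC R) (u *m diag_mx (rv2 a b) *m u^T)).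
  by apply: posdef_toC => // i; rewrite mxE; case: (i == 0).
have pB : posdef (map_mx (@toC R) (1%:M *m diag_mx (rv2 L n) *m 1%:M^T)).
  by apply: posdef_toC => // i; rewrite mxE; case: (i == 0).
have eN0 : e != 0 by rewrite gt_eqF.
have pBA : psd (map_mx (@toC R) (1%:M *m diag_mx (rv2 L n) *m 1%:M^T) -
                map_mx (@toC R) (u *m diag_mx (rv2 a b) *m u^T)).
  rewrite Eu E1 -raddfB /= mx2_sub.
  pose w : 'cV[R]_2 := \col_i (if i == 0 then 1 else - k / e).
  have e0C : 0 <= toC e by rewrite toC_ge0 ltW.
  have := psdZ e0C (psd_mul_adj (map_mx (@toC R) w)); congr psd.
  apply/matrixP => i j.
  rewrite !mxE big_ord1 adjE !mxE conj_toC -!rmorphM; congr toC.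
  by case: (i == 0); case: (j == 0); rewrite /L /n -/k; field.
have Ef x y : map_mx f (rv2 x y) = rv2 (f x) (f y).
  by apply/matrixP => i j; rewrite !mxE; case: (j == 0).
have := mf _ _ _ pA pB pBA.
rewrite (spec_calc_toC f _ uu) (spec_calc_toC f _ u1) !Ef Eu E1 -raddfB /= mx2_sub.
by move=> /(psd_diag_ge0 0); rewrite !mxE /= toC_ge0 subr_ge0.
Qed.

Lemma operator_monotone_tangent (f : R -> R) (df x : R) :
  operator_monotone f -> is_derive (1 : R) 1 f df -> 0 < x ->
  f x <= f 1 + df * (x - 1).
Proof.
move=> mf dfE x0.
(* The argument of [f] in the chord inequality for the points [x] and 1 with slack t^2; the slack
   has zero slope at 0, so [p] still has derivative [x - 1] there. *)
pose p : {poly R} := 'X^2 + (x - 1) *: 'X + 1%:P.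
have p0 : p.[0] = 1 by rewrite !hornerE /=; ring.
have dp : p^`().[0] = x - 1.
  by rewrite /p !derivD derivXn derivZ derivX derivC !hornerE /=; ring.
have dg : is_derive (0 : R) 1 (f \o horner p) (df * (x - 1)).
  by rewrite -dp; apply: is_derive1_comp; rewrite p0.
have [cg Dg] := dg; rewrite /derive in Dg; rewrite /derivable in cg.
(* The chord inequality is available for 0 < t < 1, so the limit is taken from the right. *)
have /cvg_dnbhs_at_right cg' : (fun h : R =>
    h^-1 *: (((f \o horner p) \o shift 0) (h *: 1) - (f \o horner p) 0)) @ 0^' -->
    df * (x - 1).
  by rewrite -Dg; exact: cg.
rewrite -lerBlDl -(cvg_lim _ cg')//; apply: limr_ge.
  by apply/cvg_ex; eexists; exact: cg'.
near=> t.
have t0 : 0 < t by near: t; exact: nbhs_right_gt.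
have t1 : t < 1 by near: t; exact: nbhs_right_lt.
have h := @operator_monotone_chord f x 1 t (t ^+ 2) mf x0 ltr01.
rewrite /= addr0 p0 [_ *: 1]mulr1 -ler_pdivrMl ?invrK ?invr_gt0 //.
rewrite (_ : p.[t] = t * x + (1 - t) * 1 + t ^+ 2); last by rewrite !hornerE /=; ring.
have := h _ _; rewrite t0 t1 exprn_gt0 // => /(_ isT isT); lra.
Unshelve. all: by end_near.
Qed.

End Tangent.

(** * Superoperators and the monotone metric in an eigenbasis *)

Section Metric.
Variables (R : realType) (n : nat).
Local Notation C := R[i].
Implicit Types (A B U X Y Z r : 'M[C]_n).

Lemma mxvec_ext (M N : 'M[C]_(n * n)) :
  (forall Z, mxvec Z *m M = mxvec Z *m N) -> M = N.
Proof.
move=> h; apply/row_matrixP => i.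
by rewrite !rowE -(vec_mxK (delta_mx 0 i)) h.
Qed.

Lemma mxvec_supmat A B Z :
  mxvec Z *m supmat (fun Z => A *m Z *m B) = mxvec (A *m Z *m B).
Proof. exact: (mul_vec_lin (mulmxr B \o mulmx A) Z). Qed.

Lemma mxvec_supmatr B Z : mxvec Z *m supmat (fun Z => Z *m B) = mxvec (Z *m B).
Proof. exact: (mul_vec_lin (mulmxr B) Z). Qed.

Lemma supmat_entry A B a b c d :
  supmat (fun Z => A *m Z *m B) (mxvec_index a b) (mxvec_index c d) =
  A c a * B b d.
Proof.
have -> (M : 'M[C]_(n * n)) i j : M i j = row i M 0 j by rewrite mxE.
rewrite rowE -mxvec_delta mxvec_supmat mxvecE -(mul_delta_mx (0 : 'I_1)) mulmxA -colE.
by rewrite -mulmxA -rowE mxE big_ord1 !mxE.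
Qed.

Lemma adj_supmat A B :
  adj (supmat (fun Z => A *m Z *m B)) = supmat (fun Z => adj A *m Z *m adj B).
Proof.
apply/matrixP => i j; case/mxvec_indexP: i => a b; case/mxvec_indexP: j => c d.
by rewrite adjE !supmat_entry !adjE rmorphM.
Qed.

Definition conj_supmat U : 'M[C]_(n * n) := supmat (fun Z => adj U *m Z *m U).

Lemma conj_supmat_unitary U : unitary U -> unitary (conj_supmat U).
Proof.
move=> uU; apply: mxvec_ext => Z.
rewrite adj_supmat mulmxA !mxvec_supmat mulmx1 adjK !mulmxA uU mul1mx -mulmxA uU.
by rewrite mulmx1.
Qed.

Definition schur_diag (w : 'I_n -> 'I_n -> R) : 'rV[R]_(n * n) :=
  mxvec (\matrix_(a, b) w a b).

(** Schur multiplier: entrywise multiplication by [w] in the basis [U]. Matrices act on row vectors,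
    so the leftmost factor applies first. The form is already a spectral decomposition, ready for
    [is_spec_calc]. *)
Definition schur_sup U (w : 'I_n -> 'I_n -> R) : 'M[C]_(n * n) :=
  conj_supmat U *m diag_mx (map_mx (@toC R) (schur_diag w)) *m adj (conj_supmat U).

Lemma mxvec_schur U w Z : mxvec Z *m schur_sup U w =
  mxvec (U *m (\matrix_(a, b) (toC (w a b) * (adj U *m Z *m U) a b)) *m adj U).
Proof.
rewrite /schur_sup adj_supmat adjK !mulmxA mxvec_supmat -[RHS]mxvec_supmat.
congr (_ *m _); apply/matrixP => i j; case/mxvec_indexP: j => a b.
by rewrite mul_mx_diag !ord1 mxE !mxvecE !mxE mxvecE mxE mulrC.
Qed.

Lemma spec_calc_schur U w f : unitary U ->
  spec_calc f (schur_sup U w) = schur_sup U (fun a b => f (w a b)).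
Proof.
move=> uU; apply: spec_calcE; exists (conj_supmat U), (schur_diag w).
split; first exact: conj_supmat_unitary.
split; first by [].
congr (_ *m diag_mx _ *m _); apply/matrixP => i j; case/mxvec_indexP: j => a b.
by rewrite !ord1 !mxE !mxvecE !mxE.
Qed.

Lemma schur_sup_mul U w w' : unitary U ->
  schur_sup U w *m schur_sup U w' = schur_sup U (fun a b => w a b * w' a b).
Proof.
move=> uU; rewrite /schur_sup (unitary_conj_mul _ _ (conj_supmat_unitary uU)).
rewrite diag_toC_mul; congr (_ *m diag_mx (map_mx _ _) *m _).
apply/matrixP => i j; case/mxvec_indexP: j => a b.
by rewrite !ord1 !mxE !mxvecE !mxE.
Qed.

Lemma invmx_uniq m (A B : 'M[C]_m) : A *m B = 1%:M -> invmx A = B.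
Proof.
move=> AB; have [uA _] := mulmx1_unit AB.
by rewrite -[RHS](mulKmx uA) AB mulmx1.
Qed.

Lemma schur_sup_inv U w : unitary U -> (forall a b, w a b != 0) ->
  invmx (schur_sup U w) = schur_sup U (fun a b => (w a b)^-1).
Proof.
move=> uU w0; apply: invmx_uniq; rewrite schur_sup_mul //.
rewrite /schur_sup (_ : map_mx _ _ = const_mx 1).
  by rewrite diag_const_mx mulmx1; apply: conj_supmat_unitary.
apply/matrixP => i j; case/mxvec_indexP: j => a b.
by rewrite !ord1 !mxE !mxvecE !mxE divff // rmorph1.
Qed.

(** In the eigenbasis, [r] on the left multiplies the entry at a, b by p_a, and its inverse on the
    right divides it by p_b. *)
Lemma left_right_schur U (p : 'rV[R]_n) : unitary U -> (forall i, 0 < p 0 i) ->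
  let r := U *m diag_mx (map_mx (@toC R) p) *m adj U in
  supmat (fun Z => r *m Z *m invmx r) = schur_sup U (fun a b => p 0 a / p 0 b).
Proof.
move=> uU p0 r; apply: mxvec_ext => Z; rewrite mxvec_supmat mxvec_schur.
have -> : invmx r = U *m diag_mx (map_mx (@toC R) (map_mx GRing.inv p)) *m adj U.
  apply: invmx_uniq; rewrite (unitary_conj_mul _ _ uU) diag_toC_mul.
  rewrite (_ : map_mx _ _ = const_mx 1); first by rewrite diag_const_mx mulmx1 uU.
  by apply/matrixP => i j; rewrite !mxE divff ?rmorph1 // gt_eqF.
rewrite /r !mulmxA; congr (mxvec (_ *m _)); rewrite -!mulmxA; congr (_ *m _).
rewrite !mulmxA mul_mx_diag; apply/matrixP => a b.
rewrite -!mulmxA mul_diag_mx [LHS]mxE [X in X * _ = _]mxE [RHS]mxE !mxE rmorphM.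
by rewrite mulrAC.
Qed.

Lemma right_schur U (p : 'rV[R]_n) : unitary U ->
  let r := U *m diag_mx (map_mx (@toC R) p) *m adj U in
  supmat (fun Z => Z *m r) = schur_sup U (fun a b => p 0 b).
Proof.
move=> uU r; apply: mxvec_ext => Z; rewrite mxvec_supmatr mxvec_schur.
rewrite /r !mulmxA; congr (mxvec (_ *m _)).
rewrite -{1}[Z]mul1mx -uU -!mulmxA; congr (_ *m _).
rewrite !mulmxA mul_mx_diag; apply/matrixP => a b.
by rewrite [LHS]mxE [RHS]mxE [X in _ * X]mxE mulrC.
Qed.

(** [s a b] is the eigenvalue, at the matrix unit a, b, of the superoperator to be inverted:
    P(p_a/p_b) p_b for K^(P), which for [Pbeta] is a weighted mean of p_a and p_b. *)
Definition metric_form U (s : 'I_n -> 'I_n -> R) X Y : C :=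
  \sum_a \sum_b conjc ((adj U *m X *m U) a b) * (adj U *m Y *m U) a b
    * toC (s a b)^-1.

Lemma trace_adj_mul X Y : \tr (adj X *m Y) = \sum_a \sum_b conjc (X a b) * Y a b.
Proof.
rewrite /mxtrace exchange_big; apply: eq_bigr => b _; rewrite mxE.
by apply: eq_bigr => a _; rewrite adjE.
Qed.

Lemma monotone_metricE P U (p : 'rV[R]_n) X Y : unitary U ->
  (forall i, 0 < p 0 i) -> (forall x, 0 < x -> 0 < P x) ->
  monotone_metric P (U *m diag_mx (map_mx (@toC R) p) *m adj U) X Y =
  metric_form U (fun a b => P (p 0 a / p 0 b) * p 0 b) X Y.
Proof.
move=> uU p0 P0; rewrite /monotone_metric /= (left_right_schur uU p0).
rewrite (right_schur _ uU) (spec_calc_schur _ _ uU) (schur_sup_mul _ _ uU).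
rewrite schur_sup_inv //; last first.
  by move=> a b; rewrite gt_eqF // mulr_gt0 // P0 // divr_gt0.
rewrite mxvec_schur mxvecK mulmxA mxtrace_mulC !mulmxA.
rewrite (_ : adj U *m adj X *m U = adj (adj U *m X *m U)); last first.
  by rewrite !adjM adjK !mulmxA.
rewrite trace_adj_mul /metric_form; apply: eq_bigr => a _; apply: eq_bigr => b _.
by rewrite [X in _ * X]mxE mulrA mulrAC.
Qed.

End Metric.

(** * Information matrices as Gram matrices of the metric *)

Section Fisher.
Variables (R : realType) (n d : nat).
Local Notation C := R[i].
Implicit Types (D : 'I_d -> 'M[C]_n) (s : 'I_n -> 'I_n -> R).

Definition metric_gram (U : 'M[C]_n) s D : 'M[C]_d :=
  \matrix_(i, j) metric_form U s (D i) (D j).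

Lemma metric_gram_ext U s s' D : (forall a b, s a b = s' a b) ->
  metric_gram U s D = metric_gram U s' D.
Proof.
move=> ss'; apply/matrixP => i j; rewrite !mxE; apply: eq_bigr => a _.
by apply: eq_bigr => b _; rewrite ss'.
Qed.

(** As a sum of rank-one psd matrices with weights 1/s, the Gram matrix can be handled termwise,
    both for positivity and for antitonicity in [s]. *)
Lemma metric_gram_sum U s D : metric_gram U s D =
  \sum_a \sum_b toC (s a b)^-1 *:
    (adj (\row_j (adj U *m D j *m U) a b) *m (\row_j (adj U *m D j *m U) a b)).
Proof.
apply/matrixP => i j; rewrite mxE summxE; apply: eq_bigr => a _.
rewrite summxE; apply: eq_bigr => b _.
by rewrite [RHS]mxE [X in _ = _ * X]mxE big_ord1 adjE ![(\row__ _) _ _]mxE mulrC.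
Qed.

Lemma psd_adj_mul m k (B : 'M[C]_(m, k)) : psd (adj B *m B).
Proof. by have := psd_mul_adj (adj B); rewrite adjK. Qed.

Lemma psd_metric_gram U s D : (forall a b, 0 < s a b) -> psd (metric_gram U s D).
Proof.
move=> s0; rewrite metric_gram_sum; apply: psd_sum => a; apply: psd_sum => b.
by apply: psdZ; [rewrite toC_ge0 invr_ge0 ltW | exact: psd_adj_mul].
Qed.

Lemma metric_gram_anti U s s' D : (forall a b, 0 < s a b) ->
  (forall a b, s a b <= s' a b) -> psd (metric_gram U s D - metric_gram U s' D).
Proof.
move=> s0 ss'; rewrite !metric_gram_sum -sumrB; apply: psd_sum => a.
rewrite -sumrB; apply: psd_sum => b; rewrite -scalerBl -rmorphB.
apply: psdZ; last exact: psd_adj_mul.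
rewrite toC_ge0 subr_ge0 lef_pV2 // posrE //.
exact: lt_le_trans (ss' a b).
Qed.

(** For Hermitian [D i], swapping the two indices of an entry conjugates it. *)
Lemma metric_gram_conj U s D : (forall i, adj (D i) = D i) ->
  metric_gram U (fun a b => s b a) D = map_mx (@conjc R) (metric_gram U s D).
Proof.
move=> hD; apply/matrixP => i j; rewrite !mxE /metric_form exchange_big.
rewrite conjc_sum; apply: eq_bigr => a _; rewrite conjc_sum.
apply: eq_bigr => b _; rewrite !conjcM conj_toC.
have hU k : adj (adj U *m D k *m U) = adj U *m D k *m U.
  by rewrite !adjM adjK hD mulmxA.
by rewrite -[in LHS](hU i) -[in LHS](hU j) !adjE.
Qed.

Lemma mulmx_row_form (u : 'rV[C]_d) (v : 'cV[C]_d) :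
  (adj v *m (adj u *m u) *m v) 0 0 = conjc ((u *m v) 0 0) * (u *m v) 0 0.
Proof. by rewrite !mulmxA -adjM -mulmxA mxE big_ord1 adjE. Qed.

(** Sesquilinearity reduces a matrix inequality to a scalar one for the single operator [Z]. *)
Lemma metric_gram_form U s D (v : 'cV[C]_d) :
  let Z := \sum_j v j 0 *: D j in
  (adj v *m metric_gram U s D *m v) 0 0 = metric_form U s Z Z.
Proof.
move=> Z; rewrite metric_gram_sum mulmx_sumr mulmx_suml summxE.
apply: eq_bigr => a _; rewrite mulmx_sumr mulmx_suml summxE.
apply: eq_bigr => b _; rewrite -scalemxAr -scalemxAl mxE mulmx_row_form mulrC.
suff -> : ((\row_j (adj U *m D j *m U) a b) *m v) 0 0 = (adj U *m Z *m U) a b by [].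
rewrite /Z mulmx_sumr mulmx_suml summxE mxE; apply: eq_bigr => j _.
by rewrite mxE -scalemxAr -scalemxAl [RHS]mxE mulrC.
Qed.

End Fisher.

(** * Measured information against the metric *)

Section Measurement.
Variables (R : realType) (n : nat) (X : finType) (M : X -> 'M[R[i]]_n).
Hypothesis povmM : POVM M.
Local Notation C := R[i].

Let hM x : adj (M x) = M x. Proof. exact/psd_herm/povmM.1. Qed.

(* The difference is the sum of (y_x - Y) M_x (y_x - Y)^*. *)
Lemma povm_kadison (y : X -> C) : let Y := \sum_x y x *: M x in
  psd (\sum_x (y x * conjc (y x)) *: M x - Y *m adj Y).
Proof.
move=> Y.
have := psd_sum (fun x => psd_congr ((y x)%:M - Y) (povmM.1 x)); congr psd.
have E x : ((y x)%:M - Y) *m M x *m adj ((y x)%:M - Y) =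
    (y x * conjc (y x)) *: M x - Y *m (conjc (y x) *: M x)
    - (y x *: M x *m adj Y - Y *m M x *m adj Y).
  have -> : adj ((y x)%:M - Y) = (conjc (y x))%:M - adj Y.
    rewrite adjB; congr (_ - _); apply/matrixP => i j; rewrite adjE !mxE eq_sym.
    by case: eqP => _; rewrite ?mulr1n ?mulr0n ?conjc0.
  rewrite mulmxBl mul_scalar_mx mulmxBr !mulmxBl !mul_mx_scalar scalerA.
  by rewrite -scalemxAr [_ * y x]mulrC.
rewrite (eq_bigr _ (fun x _ => E x)) !sumrB -!mulmx_suml -!mulmx_sumr povmM.2.
rewrite mulmx1 -/Y (_ : \sum_x conjc (y x) *: M x = adj Y); last first.
  by rewrite adj_sum; apply: eq_bigr => x _; rewrite adj_scale hM.
by rewrite subrr subr0.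
Qed.

(** The adjoint of [Y] is the combination with conjugate coefficients, so the second bound is the
    first one at [conjc (y x)]. *)
Lemma povm_kadison_trace (r : 'M[C]_n) (y : X -> C) : psd r ->
  let Y := \sum_x y x *: M x in
  let q := \sum_x y x * conjc (y x) * \tr (r *m M x) in
  \tr (r *m (Y *m adj Y)) <= q /\ \tr (r *m (adj Y *m Y)) <= q.
Proof.
move=> pr Y q.
have le z : \tr (r *m ((\sum_x z x *: M x) *m adj (\sum_x z x *: M x))) <=
    \sum_x z x * conjc (z x) * \tr (r *m M x).
  rewrite -subr_ge0; have := psd_trace_mul_ge0 pr (povm_kadison z).
  congr (0 <= _); rewrite mulmxBr raddfB /=; congr (_ - _).
  rewrite mulmx_sumr raddf_sum; apply: eq_bigr => x _.
  by rewrite /= -scalemxAr mxtraceZ.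
split; first exact: le.
have := le (fun x => conjc (y x)).
have -> : \sum_x conjc (y x) *: M x = adj Y.
  by rewrite adj_sum; apply: eq_bigr => x _; rewrite adj_scale hM.
rewrite adjK (_ : \sum_x _ = q) //; apply: eq_bigr => x _.
by rewrite conjcK mulrC [_ * y x]mulrC mulrC.
Qed.

Lemma conj_trace_herm (A B : 'M[C]_n) :
  adj A = A -> adj B = B -> conjc (\tr (A *m B)) = \tr (A *m B).
Proof. by move=> hA hB; rewrite -mxtr_adj adjM hA hB mxtrace_mulC. Qed.

Lemma trace_spectral_left (U Y : 'M[C]_n) (p : 'rV[R]_n) :
  \tr (U *m diag_mx (map_mx (@toC R) p) *m adj U *m (Y *m adj Y)) =
  \sum_a \sum_b toC (p 0 a) * ((adj U *m Y) a b * conjc ((adj U *m Y) a b)).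
Proof.
set D := diag_mx _; rewrite -[U *m _ *m _]mulmxA -mulmxA mxtrace_mulC.
rewrite (_ : _ *m U = D *m ((adj U *m Y) *m adj (adj U *m Y))); last first.
  by rewrite adjM adjK !mulmxA.
move: (adj U *m Y) => Z; apply: eq_bigr => a _.
rewrite /D mul_diag_mx mxE [X in X * _ = _]mxE [X in _ * X = _]mxE mulr_sumr.
by apply: eq_bigr => b _; rewrite adjE.
Qed.

Lemma sum_unitary_right (U Z : 'M[C]_n) a : unitary U ->
  \sum_b (Z *m U) a b * conjc ((Z *m U) a b) = \sum_b Z a b * conjc (Z a b).
Proof.
move=> uU.
have E (W : 'M[C]_n) : \sum_b W a b * conjc (W a b) = (W *m adj W) a a.
  by rewrite mxE; apply: eq_bigr => b _; rewrite adjE.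
by rewrite !E adjM mulmxA -[Z *m U *m _]mulmxA uU mulmx1.
Qed.

(* Variational lower bound <Z, S^-1 Z> >= 2 Re <Y, Z> - <Y, S Y> for the weight
   operator S with eigenvalues s a b, at Y = sum_x (tr (Z M_x) / tr (r M_x)) M_x. *)
Lemma metric_ge_measured (U Z : 'M[C]_n) (p : 'rV[R]_n) (u v : R) :
  let r := U *m diag_mx (map_mx (@toC R) p) *m adj U in
  unitary U -> (forall i, 0 < p 0 i) -> 0 <= u -> 0 <= v -> u + v = 1 ->
  \sum_x conjc (\tr (Z *m M x)) * \tr (Z *m M x) / \tr (r *m M x) <=
  metric_form U (fun a b => u * p 0 a + v * p 0 b) Z Z.
Proof.
move=> r uU p0 u0 v0 uv1.
have pr : psd r by apply/psd_congr/psd_diag => i; exact/ltW.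
pose c x := \tr (Z *m M x); pose t x := \tr (r *m M x).
pose y x := c x / t x; pose Y := \sum_x y x *: M x.
set Q := \sum_x _.
have ct x : conjc (t x) = t x by apply: conj_trace_herm => //; exact: psd_herm.
have EQ : \sum_x y x * conjc (y x) * t x = Q.
  apply: eq_bigr => x _; rewrite /y -/(c x) -/(t x) conjcM conjc_inv ct.
  (* An outcome of probability zero contributes 0 on both sides, the inverse of 0 being 0. *)
  have [->|t0] := eqVneq (t x) 0; first by rewrite invr0 !mulr0.
  by field.
have YZ : \tr (adj Y *m Z) = Q.
  rewrite adj_sum mulmx_suml raddf_sum; apply: eq_bigr => x _ /=.
  rewrite adj_scale hM -scalemxAl mxtraceZ mxtrace_mulC -/(c x) /y conjcM conjc_inv ct.
  by rewrite mulrAC.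
have QR : conjc Q = Q.
  rewrite -EQ conjc_sum; apply: eq_bigr => x _.
  by rewrite conjcM ct; congr (_ * _); rewrite conjcM conjcK mulrC.
pose s a b := u * p 0 a + v * p 0 b.
have s0 a b : 0 < s a b.
  rewrite /s; have [u0'|u0'] := ltrP 0 u.
    by rewrite ltr_pwDl ?mulr_gt0 ?mulr_ge0 // ltW.
  have -> : v = 1 by lra.
  have -> : u = 0 by lra.
  by rewrite mul0r add0r mul1r.
pose Y' := adj U *m Y *m U; pose Z' := adj U *m Z *m U.
have YZ' : \sum_a \sum_b conjc (Y' a b) * Z' a b = Q.
  rewrite -trace_adj_mul /Y' /Z' -YZ !adjM adjK -!mulmxA (mulmxA U) uU mul1mx.
  by rewrite mxtrace_mulC -!mulmxA uU mulmx1.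
have ZY' : \sum_a \sum_b conjc (Z' a b) * Y' a b = Q.
  rewrite -QR -YZ' conjc_sum; apply: eq_bigr => a _; rewrite conjc_sum.
  by apply: eq_bigr => b _; rewrite conjcM conjcK mulrC.
have [le1 le2] := povm_kadison_trace y pr; rewrite -/Y EQ in le1 le2.
have E1 : \tr (r *m (Y *m adj Y)) =
    \sum_a \sum_b toC (p 0 a) * (Y' a b * conjc (Y' a b)).
  rewrite trace_spectral_left; apply: eq_bigr => a _.
  by rewrite -!mulr_sumr /Y' (sum_unitary_right (adj U *m Y) a uU).
have E2 : \tr (r *m (adj Y *m Y)) =
    \sum_a \sum_b toC (p 0 b) * (Y' a b * conjc (Y' a b)).
  rewrite -{2}[Y]adjK trace_spectral_left [RHS]exchange_big; apply: eq_bigr => b _.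
  rewrite -!mulr_sumr -(sum_unitary_right _ _ uU); congr (_ * _).
  apply: eq_bigr => a _.
  rewrite (_ : adj U *m adj Y *m U = adj Y'); last by rewrite /Y' !adjM adjK mulmxA.
  by rewrite !adjE conjcK mulrC.
have le3 : \sum_a \sum_b toC (s a b) * (Y' a b * conjc (Y' a b)) <= Q.
  (* <Y, S Y> mixes the traces of r Y Y^* and r Y^* Y with weights [u] and [v]; each trace is at
     most [Q]. *)
  have -> : \sum_a \sum_b toC (s a b) * (Y' a b * conjc (Y' a b)) =
     toC u * \tr (r *m (Y *m adj Y)) + toC v * \tr (r *m (adj Y *m Y)).
    rewrite E1 E2 !mulr_sumr -big_split; apply: eq_bigr => a _ /=.
    rewrite !mulr_sumr -big_split; apply: eq_bigr => b _ /=.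
    by rewrite rmorphD !rmorphM; ring.
  have -> : Q = toC u * Q + toC v * Q by rewrite -mulrDl -rmorphD uv1 rmorph1 mul1r.
  by apply: lerD; apply: ler_wpM2l => //; rewrite toC_ge0.
(* Completing the square: s^-1 |Z' - s Y'|^2 is summed over all entries. Both cross terms equal [Q],
   and the last term is at most [Q]. *)
have : 0 <= \sum_a \sum_b toC (s a b)^-1 *
    ((Z' a b - toC (s a b) * Y' a b) * conjc (Z' a b - toC (s a b) * Y' a b)).
  apply: sumr_ge0 => a _; apply: sumr_ge0 => b _; apply: mulr_ge0.
    by rewrite toC_ge0 invr_ge0 ltW.
  exact: mul_conjC_ge0.
have -> : \sum_a \sum_b toC (s a b)^-1 *
    ((Z' a b - toC (s a b) * Y' a b) * conjc (Z' a b - toC (s a b) * Y' a b)) =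
   metric_form U s Z Z - \sum_a \sum_b conjc (Y' a b) * Z' a b -
   \sum_a \sum_b conjc (Z' a b) * Y' a b +
   \sum_a \sum_b toC (s a b) * (Y' a b * conjc (Y' a b)).
  rewrite /metric_form -!sumrB -big_split; apply: eq_bigr => a _ /=.
  rewrite -!sumrB -big_split; apply: eq_bigr => b _ /=.
  rewrite -/Z' conjcB conjcM conj_toC fmorphV /=.
  have : toC (s a b) != 0 by rewrite fmorph_eq0 gt_eqF.
  by move: (toC (s a b)) (Z' a b) (Y' a b) => sab z w sab0; field.
rewrite YZ' ZY' => h.
rewrite -subr_ge0; apply: (le_trans h).
by rewrite -[X in _ <= X]addr0 -addrA lerD2l addrC subr_le0.
Qed.

End Measurement.

(** * The Cramer-Rao matrix inequality *)

Section CramerRao.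
Variables (R : realType) (d : nat).
Local Notation C := R[i].

(* V - J^-1 = sum_x p_x w_x w_x^* with w_x = a_x - p_x^-1 J^-1 q_x. *)
Lemma cramer_rao (X : finType) (p : X -> C) (a q : X -> 'cV[C]_d) :
  (forall x, 0 <= p x) -> (forall x, p x = 0 -> q x = 0) ->
  \sum_x a x *m adj (q x) = 1%:M ->
  let J := \sum_x (p x)^-1 *: (q x *m adj (q x)) in
  J \in unitmx -> psd (\sum_x p x *: (a x *m adj (a x)) - invmx J).
Proof.
move=> p0 q0 aq1 J uJ.
have pJ : psd J.
  by apply: psd_sum => x; apply: psdZ; [rewrite invr_ge0|exact: psd_mul_adj].
have hK : adj (invmx J) = invmx J by rewrite adj_inv // psd_herm.
have qa1 : \sum_x q x *m adj (a x) = 1%:M.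
  have := congr1 (@adj R d d) aq1; rewrite adj_sum => h.
  transitivity (adj (1%:M : 'M[C]_d)).
    by rewrite -h; apply: eq_bigr => x _; rewrite adjM adjK.
  by apply/matrixP => i j; rewrite adjE !mxE eq_sym conjc_nat.
pose w x := a x - (p x)^-1 *: (invmx J *m q x).
have := psd_sum (fun x => psdZ (p0 x) (psd_mul_adj (w x))); congr psd.
have E x : p x *: (w x *m adj (w x)) =
    p x *: (a x *m adj (a x)) - invmx J *m (q x *m adj (a x))
    - (a x *m adj (q x) *m invmx J
       - invmx J *m ((p x)^-1 *: (q x *m adj (q x))) *m invmx J).
  rewrite /w adjB adj_scale adjM hK.
  (* At probability zero [q x] vanishes and the inverse of [p x] is 0, so every term is 0. *)
  have [px0|px0] := eqVneq (p x) 0.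
    by rewrite px0 (q0 _ px0) adj0 !(mul0mx, mulmx0, scale0r, scaler0, subr0).
  have -> : conjc (p x)^-1 = (p x)^-1.
    by rewrite conjc_inv -[conjc _]/(Num.conj _) geC0_conj.
  rewrite mulmxBl !mulmxBr !scalerBr -!scalemxAl -!scalemxAr !scalerA divff //.
  rewrite !scale1r div1r -!scalemxAl !mulmxA !opprB !addrA.
  rewrite [LHS]addrAC [RHS]addrAC; congr (_ + _).
  by rewrite addrAC.
rewrite (eq_bigr _ (fun x _ => E x)) !sumrB -!mulmx_suml -!mulmx_sumr qa1 aq1.
by rewrite -/J mul1mx mulmx1 mulVmx // mul1mx subrr subr0.
Qed.

End CramerRao.

(** * Consequences of strict positivity of the state *)

Section Positive.
Variables (R : realType) (n : nat).
Local Notation C := R[i].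

Lemma posdefP (r : 'M[C]_n) : posdef r ->
  exists (U : 'M[C]_n) (p : 'rV[R]_n), [/\ unitary U,
    r = U *m diag_mx (map_mx (@toC R) p) *m adj U & forall i, 0 < p 0 i].
Proof.
move=> [/spectral_psd[U [p [uU -> p0]]] ur]; exists U, p; split => // i.
rewrite lt_def p0 andbT; move: ur; rewrite !unitmx_mul => /andP[/andP[_ uD] _].
move: uD; rewrite unitmxE det_diag unitfE => /prodf_neq0/(_ i isT).
by rewrite mxE; apply: contraNneq => ->; rewrite rmorph0.
Qed.

Lemma psd_trace0 (A : 'M[C]_n) : psd A -> \tr A = 0 -> A = 0.
Proof.
move=> /psd_sqrt_exists[S [pS <-]]; rewrite -{1}(psd_herm pS) trace_adj_mul => h.
suff -> : S = 0 by rewrite mul0mx.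
have ge0 a b : 0 <= conjc (S a b) * S a b by rewrite mulrC; exact: mul_conjC_ge0.
apply/matrixP => a b; rewrite mxE.
have /(_ a isT) := psumr_eq0P (fun a _ => sumr_ge0 _ (fun b _ => ge0 a b)) h.
move=> /(psumr_eq0P (fun b _ => ge0 a b))/(_ b isT)/eqP.
by rewrite mulf_eq0 conjc_eq0 orbb => /eqP.
Qed.

(** In the eigenbasis of [r] the trace sums nonnegative diagonal entries with strictly positive
    weights. Hence an outcome of probability zero has a zero POVM element and a zero score. *)
Lemma posdef_trace_mul0 (r A : 'M[C]_n) :
  posdef r -> psd A -> \tr (r *m A) = 0 -> A = 0.
Proof.
move=> /posdefP[U [p [uU -> p0]]] pA h; apply: psd_trace0 => //.
have pB := psd_cong U pA.
have h' : \sum_i toC (p 0 i) * (adj U *m A *m U) i i = 0.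
  rewrite -[RHS]h -[U *m _ *m _]mulmxA -[U *m (_ *m _) *m A]mulmxA mxtrace_mulC -!mulmxA.
  by apply: eq_bigr => i _; rewrite mul_diag_mx [RHS]mxE [X in _ = X * _]mxE.
have ge0 i : 0 <= toC (p 0 i) * (adj U *m A *m U) i i.
  by apply: mulr_ge0; [rewrite toC_ge0 ltW|exact: psd_diag_ge0].
rewrite -(trace_unitary A uU); apply: big1 => i _.
have /(_ i isT)/eqP := psumr_eq0P (fun i _ => ge0 i) h'.
by rewrite mulf_eq0 fmorph_eq0 gt_eqF //= => /eqP.
Qed.

End Positive.

(** * Derivatives of the family of states *)

Section Derivative.
Variables (R : realType) (n d : nat) (Theta : set 'rV[R]_d).
Variables (rho : 'rV[R]_d -> 'M[R[i]]_n) (th0 : 'rV[R]_d).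
Hypotheses (oT : open Theta) (T0 : Theta th0).
Hypothesis dens : forall t, Theta t -> density_op (rho t).
Hypothesis diff : forall a b, differentiable (fun t => complex.Re (rho t a b)) th0 /\
               differentiable (fun t => complex.Im (rho t a b)) th0.

Let nearT : \forall t \near th0, Theta t.
Proof. exact: open_nbhs_nbhs. Qed.

(** Derivatives depend only on values near [th0], and [Theta] is open, so the symmetry of the
    entries on [Theta] can be differentiated. *)
Lemma pderiv_herm i : adj (pderiv rho th0 i) = pderiv rho th0 i.
Proof.
apply/matrixP => a b; rewrite adjE !mxE /=; congr Complex.
  apply: near_eq_derive; near=> t.
  have Tt : Theta t by near: t.
  have := congr1 (fun A : 'M[R[i]]_n => A a b) (psd_herm (dens Tt).1).
  rewrite /= adjE => <-.
  by case: (rho t b a).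
rewrite -deriveN; last exact/diff_derivable/(diff b a).2.
apply: near_eq_derive; near=> t.
have Tt : Theta t by near: t.
have := congr1 (fun A : 'M[R[i]]_n => A a b) (psd_herm (dens Tt).1).
  rewrite /= adjE => <-.
by rewrite /= [LHS]/GRing.opp /=; case: (rho t b a).
Unshelve. all: by end_near.
Qed.

(** Near [th0] the real part of the trace is constantly 1 and its imaginary part constantly 0. *)
Lemma pderiv_trace i : \tr (pderiv rho th0 i) = 0.
Proof.
have ReS (F : 'I_n -> R[i]) : complex.Re (\sum_a F a) = \sum_a complex.Re (F a).
  by apply: (big_morph (@complex.Re R)) => // -[? ?] [? ?].
have ImS (F : 'I_n -> R[i]) : complex.Im (\sum_a F a) = \sum_a complex.Im (F a).
  by apply: (big_morph (@complex.Im R)) => // -[? ?] [? ?].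
apply/eqP; rewrite eq_complex /mxtrace ReS ImS; apply/andP; split; apply/eqP.
  rewrite (eq_bigr (fun a =>
    'D_(delta_mx 0 i) (fun t => complex.Re (rho t a a)) th0)); last first.
    by move=> a _; rewrite mxE.
  rewrite -derive_sum; last by move=> a; exact/diff_derivable/(diff a a).1.
  transitivity ('D_(delta_mx 0 i) (cst (1 : R) : 'rV[R]_d -> R) th0); last first.
    exact: derive_cst.
  apply: near_eq_derive; near=> t.
  have Tt : Theta t by near: t.
  by have := congr1 (@complex.Re R) (dens Tt).2; rewrite /mxtrace ReS fct_sumE.
rewrite (eq_bigr (fun a =>
    'D_(delta_mx 0 i) (fun t => complex.Im (rho t a a)) th0)); last first.
    by move=> a _; rewrite mxE.
rewrite -derive_sum; last by move=> a; exact/diff_derivable/(diff a a).2.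
transitivity ('D_(delta_mx 0 i) (cst (0 : R) : 'rV[R]_d -> R) th0); last first.
  exact: derive_cst.
apply: near_eq_derive; near=> t.
have Tt : Theta t by near: t.
by have := congr1 (@complex.Im R) (dens Tt).2; rewrite /mxtrace ImS fct_sumE.
Unshelve. all: by end_near.
Qed.

End Derivative.

(** * The affine functions P^(beta) *)

Section Pbeta.
Variable R : realType.

Lemma Pbeta_gt0 (b x : R) : -1 <= b <= 1 -> 0 < x -> 0 < Pbeta b x.
Proof.
move=> /andP[b1 b2] x0; rewrite /Pbeta.
have [xl|xl] := lerP x 1; nra.
Qed.

Lemma Pbeta_mul (b x y : R) : y != 0 ->
  Pbeta b (x / y) * y = (1 + b) / 2 * x + (1 - b) / 2 * y.
Proof. by move=> y0; rewrite /Pbeta; field. Qed.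

End Pbeta.

(** * Quantum Fisher information: order and conjugation *)

Section QuantumFisher.
Variables (R : realType) (n d : nat).
Variables (rho : 'rV[R]_d -> 'M[R[i]]_n) (th0 : 'rV[R]_d).
Local Notation C := R[i].
Local Notation r := (rho th0).
Local Notation D := (pderiv rho th0).
Variables (U : 'M[C]_n) (p : 'rV[R]_n).
Hypothesis uU : unitary U.
Hypothesis rE : r = U *m diag_mx (map_mx (@toC R) p) *m adj U.
Hypothesis p0 : forall i, 0 < p 0 i.

Lemma quantum_fisher_gram f : (forall x, 0 < x -> 0 < f x) ->
  quantum_fisher f rho th0 =
  metric_gram U (fun a b => f (p 0 a / p 0 b) * p 0 b) D.
Proof. by move=> f0; apply/matrixP => i j; rewrite !mxE rE monotone_metricE. Qed.

Let weight_gt0 f : (forall x, 0 < x -> 0 < f x) ->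
  forall a b, 0 < f (p 0 a / p 0 b) * p 0 b.
Proof. by move=> f0 a b; rewrite mulr_gt0 // f0 // divr_gt0. Qed.

Lemma psd_quantum_fisher f : (forall x, 0 < x -> 0 < f x) ->
  psd (quantum_fisher f rho th0).
Proof.
by move=> f0; rewrite quantum_fisher_gram //; apply/psd_metric_gram/weight_gt0.
Qed.

(** A larger function gives larger weights, which enter the metric through their inverses. *)
Lemma quantum_fisher_anti f g : (forall x, 0 < x -> 0 < f x) ->
  (forall x, 0 < x -> f x <= g x) ->
  psd (quantum_fisher f rho th0 - quantum_fisher g rho th0).
Proof.
move=> f0 fg.
have g0 x : 0 < x -> 0 < g x by move=> x0; apply: lt_le_trans (fg x x0); exact: f0.
rewrite !quantum_fisher_gram //; apply: metric_gram_anti; first exact: weight_gt0.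
by move=> a b; apply: ler_wpM2r; [exact/ltW|apply/fg/divr_gt0].
Qed.

(** Changing the sign of [b] exchanges the coefficients of the two eigenvalues, that is, transposes
    the weights. *)
Lemma quantum_fisher_betaN (b : R) : (forall i, adj (D i) = D i) ->
  -1 <= b <= 1 ->
  quantum_fisher (Pbeta (- b)) rho th0 =
  map_mx (@conjc R) (quantum_fisher (Pbeta b) rho th0).
Proof.
move=> hD b1; have b1' : -1 <= - b <= 1.
  by move/andP: b1 => [? ?]; apply/andP; split; lra.
rewrite !quantum_fisher_gram; try by move=> x; exact: Pbeta_gt0.
rewrite -metric_gram_conj //; apply: metric_gram_ext => a c.
by rewrite !Pbeta_mul ?gt_eqF // opprK addrC.
Qed.

End QuantumFisher.

(** * Classical Fisher information, the covariance and the quantum information *)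

Section ClassicalFisher.
Variables (R : realType) (n d : nat) (X : finType).
Variables (rho : 'rV[R]_d -> 'M[R[i]]_n) (th0 : 'rV[R]_d) (M : X -> 'M[R[i]]_n).
Local Notation C := R[i].
Local Notation r := (rho th0).
Local Notation D := (pderiv rho th0).
Hypothesis hD : forall i, adj (D i) = D i.
Hypothesis posr : posdef r.
Hypothesis povmM : POVM M.

Let hM x : adj (M x) = M x. Proof. exact/psd_herm/povmM.1. Qed.
Let score x : 'rV[C]_d := \row_j \tr (D j *m M x).

(** The scores are real, so products of scores take the rank-one form with an adjoint on which
    [cramer_rao] operates. *)
Lemma classical_fisher_sum : classical_fisher rho th0 M =
  \sum_x (\tr (r *m M x))^-1 *: (adj (score x) *m score x).
Proof.
apply/matrixP => i j; rewrite mxE summxE; apply: eq_bigr => x _.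
rewrite [RHS]mxE [X in _ = _ * X]mxE big_ord1 adjE ![score _ _ _]mxE.
by rewrite conj_trace_herm // mulrC.
Qed.

Lemma psd_classical_fisher : psd (classical_fisher rho th0 M).
Proof.
rewrite classical_fisher_sum; apply: psd_sum => x; apply: psdZ.
  by rewrite invr_ge0; apply: psd_trace_mul_ge0; [case: posr|exact: povmM.1].
exact: psd_adj_mul.
Qed.

Lemma classical_fisher_real :
  map_mx (@conjc R) (classical_fisher rho th0 M) = classical_fisher rho th0 M.
Proof.
have hr : adj r = r by apply: psd_herm; case: posr.
apply/matrixP => i j; rewrite !mxE conjc_sum; apply: eq_bigr => x _.
rewrite !conjcM conjc_inv.
exact: (congr2 *%R (congr2 *%R (conj_trace_herm (hD i) (hM x))
  (conj_trace_herm (hD j) (hM x))) (congr1 GRing.inv (conj_trace_herm hr (hM x)))).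
Qed.

Lemma cov_matrix_ge (th : X -> 'rV[R]_d) : (forall j, \tr (D j) = 0) ->
  locally_unbiased rho th0 M th -> classical_fisher rho th0 M \in unitmx ->
  psd (cov_matrix rho th0 M th - invmx (classical_fisher rho th0 M)).
Proof.
move=> trD [_ unb] uJ.
pose a x : 'cV[C]_d := \col_i toC (th x 0 i - th0 0 i).
have p0 x : 0 <= \tr (r *m M x).
  by apply: psd_trace_mul_ge0; [case: posr|exact: povmM.1].
have q0 x : \tr (r *m M x) = 0 -> adj (score x) = 0.
  move=> /(posdef_trace_mul0 posr (povmM.1 x)) Mx0.
  by apply/matrixP => i j; rewrite adjE !mxE Mx0 mulmx0 mxtrace0 conjc0.
have aq1 : \sum_x a x *m adj (adj (score x)) = 1%:M.
  apply/matrixP => i j; rewrite summxE mxE -(unb i j).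
  (* Centering at [th0] is harmless: the subtracted terms add up to a multiple of the trace of
     [D j], which is 0. *)
  transitivity (\sum_x toC (th x 0 i) * \tr (D j *m M x) -
                toC (th0 0 i) * \tr (D j *m \sum_x M x)).
    rewrite mulmx_sumr raddf_sum /= mulr_sumr -sumrB; apply: eq_bigr => x _.
    by rewrite adjK mxE big_ord1 !mxE rmorphB mulrBl.
  by rewrite povmM.2 mulmx1 trD mulr0 subr0.
have := cramer_rao p0 q0 aq1; cbv zeta.
under eq_bigr do rewrite adjK.
rewrite -classical_fisher_sum => /(_ uJ); congr (psd (_ - _)).
apply/matrixP => i j; rewrite mxE summxE; apply: eq_bigr => x _.
by rewrite !mxE big_ord1 adjE !mxE conj_toC -rmorphM mulrC.
Qed.

(** Tested on a vector, this is [metric_ge_measured] at the corresponding combination of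
    derivatives, with weights [(1 + b) / 2] and [(1 - b) / 2]. *)
Lemma quantum_fisher_ge_classical (U : 'M[C]_n) (p : 'rV[R]_n) (b : R) :
  unitary U -> r = U *m diag_mx (map_mx (@toC R) p) *m adj U ->
  (forall i, 0 < p 0 i) -> -1 <= b <= 1 ->
  psd (quantum_fisher (Pbeta b) rho th0 - classical_fisher rho th0 M).
Proof.
move=> uU rE p0 b1 v.
rewrite (quantum_fisher_gram uU rE p0); last by move=> x; exact: Pbeta_gt0.
have sE a c : Pbeta b (p 0 a / p 0 c) * p 0 c =
    (1 + b) / 2 * p 0 a + (1 - b) / 2 * p 0 c by rewrite Pbeta_mul ?gt_eqF.
rewrite (metric_gram_ext _ _ sE).
rewrite mulmxBr mulmxBl mxE [X in _ + X]mxE subr_ge0 metric_gram_form.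
move/andP: b1 => [b1 b2].
have u0 : 0 <= (1 + b) / 2 by lra.
have v0 : 0 <= (1 - b) / 2 by lra.
have uv : (1 + b) / 2 + (1 - b) / 2 = 1 by field.
apply: le_trans (metric_ge_measured povmM (\sum_j v j 0 *: D j) uU p0 u0 v0 uv).
rewrite -rE classical_fisher_sum mulmx_sumr mulmx_suml summxE le_eqVlt; apply/orP; left.
apply/eqP; apply: eq_bigr => x _.
rewrite -scalemxAr -scalemxAl mxE mulmx_row_form mulrC.
suff -> : (score x *m v) 0 0 = \tr ((\sum_j v j 0 *: D j) *m M x) by [].
rewrite mulmx_suml raddf_sum mxE; apply: eq_bigr => j _ /=.
by rewrite mxE -scalemxAl mxtraceZ mulrC.
Qed.

End ClassicalFisher.

(** * The chain of inequalities *)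

Lemma adj_inv_psd (R : realType) (d : nat) (J : 'M[R[i]]_d) :
  psd J -> J \in unitmx -> adj (invmx J) = invmx J.
Proof. by move=> pJ uJ; rewrite adj_inv // psd_herm. Qed.

Lemma Cbound_anti (R : realType) (d : nat) (G : 'M[R]_d) (J1 J2 : 'M[R[i]]_d) :
  G^T = G -> psd (map_mx (@toC R) G) -> psd J1 -> J1 \in unitmx ->
  J2 \in unitmx -> psd (J2 - J1) -> Cbound G J2 <= Cbound G J1.
Proof.
move=> sG pG p1 u1 u2 p21.
have p2 : psd J2 by have := psdD p21 p1; rewrite subrK.
exact: (Cbound_mono sG pG (adj_inv_psd p1 u1) (adj_inv_psd p2 u2)
  (psd_inv_anti p1 u1 u2 p21)).
Qed.

Theorem theorem1 (R : realType) (n d : nat) (Theta : set 'rV[R]_d)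
  (rho : 'rV[R]_d -> 'M[R[i]]_n) (th0 : 'rV[R]_d)
  (X : finType) (M : X -> 'M[R[i]]_n) (th : X -> 'rV[R]_d)
  (G : 'M[R]_d) (P : R -> R) (beta : R) :
  open Theta -> Theta th0 ->
  (forall t, Theta t -> density_op (rho t)) ->
  (forall a b, differentiable (fun t => complex.Re (rho t a b)) th0 /\
               differentiable (fun t => complex.Im (rho t a b)) th0) ->
  posdef (rho th0) ->
  POVM M -> (forall x, Theta (th x)) ->
  locally_unbiased rho th0 M th ->
  G^T = G -> (forall v : 'cV[R]_d, 0 <= (v^T *m G *m v) 0 0) ->
  operator_monotone P -> (forall x, 0 < x -> 0 < P x) -> P 1 = 1 ->
  -1 <= beta <= 1 -> is_derive (1 : R) 1 P ((1 + beta) / 2) ->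
  classical_fisher rho th0 M \in unitmx ->
  quantum_fisher (Pbeta `|beta|) rho th0 \in unitmx ->
  quantum_fisher P rho th0 \in unitmx ->
  [/\ \tr (map_mx (@toC R) G *m invmx (classical_fisher rho th0 M))
        <= \tr (map_mx (@toC R) G *m cov_matrix rho th0 M th),
      Cbound G (quantum_fisher (Pbeta `|beta|) rho th0)
        <= \tr (map_mx (@toC R) G *m invmx (classical_fisher rho th0 M)) &
      Cbound G (quantum_fisher P rho th0)
        <= Cbound G (quantum_fisher (Pbeta `|beta|) rho th0)].

Proof.
move=> oT T0 dens dif posr povmM _ unb sG pG mP P0 P1 b11 dP uJM uJb uJP.
have hD := pderiv_herm oT T0 dens dif.
have trD := pderiv_trace oT T0 dens dif.
have pGc := psd_toC sG pG.
have [U [p [uU rE p0]]] := posdefP posr.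
have B0 c : -1 <= c <= 1 -> forall x : R, 0 < x -> 0 < Pbeta c x.
  by move=> c1 x; exact: Pbeta_gt0.
have b01 : -1 <= `|beta| <= 1.
  by rewrite ler_norml b11 (le_trans _ (normr_ge0 _)) // lerN10.
split.
- have pV := cov_matrix_ge hD posr povmM trD unb uJM.
  have := psd_trace_mul_ge0 pGc pV.
  by rewrite mulmxBr raddfB subr_ge0.
(* The classical information matrix is real, so the trace is its [Cbound] and antitonicity
   applies. *)
- rewrite -(Cbound_real G (classical_fisher_real hD posr povmM)).
  have pJ := psd_classical_fisher hD posr povmM.
  have pB := quantum_fisher_ge_classical hD povmM uU rE p0 b01.
  exact: (Cbound_anti sG pGc pJ uJM uJb pB).
(* The tangent to [P] at 1 is [Pbeta beta]. *)
have Pb x : 0 < x -> P x <= Pbeta beta x.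
  move=> x0; apply: le_trans (operator_monotone_tangent mP dP x0) _.
  by rewrite P1 /Pbeta; lra.
have betaE : beta = `|beta| \/ beta = - `|beta|.
  by case: (ger0P beta) => _; [left|right; rewrite opprK].
(* Stated for a variable [c], as rewriting [beta] to plus or minus its absolute value would also act
   inside that absolute value. When [beta = - c], conjugation transfers invertibility and preserves
   the bound. *)
have H c : beta = c \/ beta = - c -> -1 <= c <= 1 ->
    quantum_fisher (Pbeta c) rho th0 \in unitmx ->
    quantum_fisher (Pbeta beta) rho th0 \in unitmx /\
    Cbound G (quantum_fisher (Pbeta beta) rho th0) <=
    Cbound G (quantum_fisher (Pbeta c) rho th0).
  move=> bc c1 uJc; case: bc => ->; first by split; [exact: uJc|exact: lexx].
  have pJ := psd_quantum_fisher uU rE p0 (B0 _ c1).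
  rewrite (quantum_fisher_betaN uU rE p0 hD c1) map_unitmx.
  by split; [exact: uJc|rewrite (Cbound_conj sG (adj_inv_psd pJ uJc))].
have [uJ leC] := H _ betaE b01 uJb.
have pJ := psd_quantum_fisher uU rE p0 (B0 _ b11).
have pPB := quantum_fisher_anti uU rE p0 P0 Pb.
exact: le_trans (Cbound_anti sG pGc pJ uJ uJP pPB) leC.
Qed.
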